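(* Let $s\ge1$ be an integer. For the LIM$(k_1,k_2,s)$ method with stepsize $h$, producing $y_1$ from $y_0$, if $k_1,k_2\ge s$ one has $$y_1-y(h)=O(h^{2s+1})\qquad(h\to0),$$ where $y(t)$ is the solution of $\dot y=S(y)\nabla H(y)$, $y(0)=y_0$.
   Context: Consider the problem $\dot y=S(y)\nabla H(y)$, $t\in[0,h]$, $y(0)=y_0\in\mathbb{R}^m$, where $H$ is real-valued and $S(y)=-S(y)^\top$ is an $m\times m$ skew-symmetric matrix for every $y$. $S$ and $\nabla H$ are assumed to be of class $C^\infty$ in a neighborhood of $y_0$. $\{P_i\}_{i\ge0}$ denotes the Legendre polynomial basis orthonormal on $[0,1]$: $P_i$ has degree $i$, $P_0\equiv1$, and $\int_0^1P_i(x)P_j(x)\,dx=\delta_{ij}$. The method LIM$(k_1,k_2,s)$ (discrete line integral method with parameters $k_1,k_2,s$): let $(\hat c_\ell,\hat b_\ell)$, $\ell=1,\dots,k_1$, and $(c_\ell,b_\ell)$, $\ell=1,\dots,k_2$, be the abscissae and weights of the Gauss-Legendre quadrature formulae on $[0,1]$ with $k_1$ and $k_2$ nodes (of order $2k_1$ and $2k_2$), respectively. The method computes a polynomial $u$ of degree at most $s$, with values in $\mathbb{R}^m$, such that $$u(ch)=y_0+h\sum_{i=0}^{s-1}\int_0^cP_i(x)\,dx\,\hat\Gamma_i,\quad c\in[0,1],\qquad \hat\Gamma_i=\sum_{j=0}^{s-1}\hat\rho_{ij}\hat\gamma_j,$$ $$\hat\rho_{ij}=\sum_{\ell=1}^{k_1}\hat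 b_\ell P_i(\hat c_\ell)P_j(\hat c_\ell)S(u(\hat c_\ell h)),\qquad \hat\gamma_j=\sum_{\ell=1}^{k_2}b_\ell P_j(c_\ell)\nabla H(u(c_\ell h)),\qquad i,j=0,\dots,s-1,$$ and sets $y_1:=u(h)=y_0+h\hat\Gamma_0$. The polynomial $u=u_h$ depends on $h$; for all sufficiently small $h>0$ it is taken to be a solution of its defining equations whose values on $[0,h]$ remain in a fixed compact neighborhood of $y_0$ on which $S$ and $H$ are smooth. The $O(\cdot)$ symbol refers to $h\to0^+$ with everything else fixed. *)

(* Defs.v *)
From HB Require Import structures.
From mathcomp Require Import all_boot all_order all_algebra.
From mathcomp Require Import all_classical all_reals all_analysis.

Set Implicit Arguments.
Unset Strict Implicit.
Unset Printing Implicit Defensive.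

Import Order.TTheory GRing.Theory Num.Theory.
Import numFieldNormedType.Exports.

Local Open Scope classical_set_scope.
Local Open Scope ring_scope.

(* In finite dimension ['d f] is of class C^k as soon as ['d f _ v = 'D_v f] is
   for every fixed direction [v]. *)
Fixpoint Ck (R : realType) (V W : normedModType R) (k : nat) (U : set V)
    (f : V -> W) : Prop :=
  if k is k'.+1 then
    (forall x, U x -> differentiable f x) /\ (forall v, Ck k' U ('D_v f))
  else forall x, U x -> {for x, continuous f}.

Definition smooth (R : realType) (V W : normedModType R) (U : set V)
    (f : V -> W) : Prop :=
  forall k, Ck k U f.

Definition gradient (R : realType) (m : nat) (H : 'cV[R]_m -> R)
    (x : 'cV[R]_m) : 'cV[R]_m :=
  \col_i 'D_(delta_mx i ord0) H x.

Definition integral_poly (R : realType) (a b : R) (p : {poly R}) : R :=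
  \int[@lebesgue_measure R]_(x in `[a, b]) p.[x].

(* The sign of [P i] for [i > 0] is left free. *)
Definition legendre_basis (R : realType) (P : nat -> {poly R}) : Prop :=
  [/\ P 0%N = 1,
      forall i, size (P i) = i.+1 &
      forall i j, integral_poly 0 1 (P i * P j) = (i == j)%:R].

(* Abscissae: the zeros of the [k]-th Legendre polynomial.  Weights: the
   interpolatory ones, i.e. the integrals over [0, 1] of the Lagrange
   polynomials of the abscissae. *)
Definition gauss_legendre (R : realType) (P : nat -> {poly R}) (k : nat)
    (c b : 'I_k -> R) : Prop :=
  [/\ injective c,
      forall l, root (P k) (c l) &
      forall l, b l = integral_poly 0 1
        (\prod_(j < k | j != l) ((c l - c j)^-1 *: ('X - (c j)%:P)))].

Definition poly_curve (R : realType) (m : nat) (u : 'cV[{poly R}]_m) (t : R)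
    : 'cV[R]_m :=
  \col_i (u i ord0).[t].

Definition LIM_rho (R : realType) (m k : nat) (P : nat -> {poly R})
    (c b : 'I_k -> R) (S : 'cV[R]_m -> 'M[R]_m) (h : R) (u : R -> 'cV[R]_m)
    (i j : nat) : 'M[R]_m :=
  \sum_(l < k) (b l * (P i).[c l] * (P j).[c l]) *: S (u (c l * h)).

Definition LIM_gamma (R : realType) (m k : nat) (P : nat -> {poly R})
    (c b : 'I_k -> R) (H : 'cV[R]_m -> R) (h : R) (u : R -> 'cV[R]_m)
    (j : nat) : 'cV[R]_m :=
  \sum_(l < k) (b l * (P j).[c l]) *: gradient H (u (c l * h)).

Definition LIM_Gamma (R : realType) (m k1 k2 s : nat) (P : nat -> {poly R})
    (c1 b1 : 'I_k1 -> R) (c2 b2 : 'I_k2 -> R)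
    (S : 'cV[R]_m -> 'M[R]_m) (H : 'cV[R]_m -> R) (h : R)
    (u : R -> 'cV[R]_m) (i : nat) : 'cV[R]_m :=
  \sum_(j < s) LIM_rho P c1 b1 S h u i j *m LIM_gamma P c2 b2 H h u j.

(* [u] is the polynomial computed by LIM(k1, k2, s) with stepsize [h]. *)
Definition LIM_poly (R : realType) (m k1 k2 s : nat) (P : nat -> {poly R})
    (c1 b1 : 'I_k1 -> R) (c2 b2 : 'I_k2 -> R)
    (S : 'cV[R]_m -> 'M[R]_m) (H : 'cV[R]_m -> R) (y0 : 'cV[R]_m) (h : R)
    (u : 'cV[{poly R}]_m) : Prop :=
  (forall i, (size (u i ord0) <= s.+1)%N) /\
  (forall c : R, 0 <= c <= 1 ->
     poly_curve u (c * h) =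
     y0 + h *: \sum_(i < s) integral_poly 0 c (P i) *:
       LIM_Gamma s P c1 b1 c2 b2 S H h (poly_curve u) i).

(* No one-sided derivatives are required at the endpoints: for continuous [f],
   continuity of [y] there and the interior equation imply them. *)
Definition solves_ivp (R : realType) (m : nat) (f : 'cV[R]_m -> 'cV[R]_m)
    (y0 : 'cV[R]_m) (T : R) (y : R -> 'cV[R]_m) : Prop :=
  [/\ y 0 = y0,
      {within `[0, T], continuous y} &
      forall t : R, 0 < t < T -> is_derive t (1 : R) y (f (y t))].

(* Main.v *)
(* Rescale time to [c = t / h] in [0, 1] and call a polynomial in [c] graded if
   its [j]-th coefficient is [O(h^j)].  Smooth functions along a graded curve
   are graded up to [O(h^N)], and the Legendre coefficient of index [i] of a
   graded polynomial, exact or computed by a quadrature of order at least [2 s],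
   is [O(h^i)].  Hence, by induction on [N], the method's polynomial is graded.

   Projecting on degree [< s] and replacing integrals by Gauss sums both change
   the integral of a product of graded polynomials by [O(h^(2s))] only.  So the
   defect [D] of the method is [O(h^s)], and its integral against any graded [x]
   is [O(h^(2s))].  The first fact makes the error [e] an [O(h^(s+1))].  For the
   second, let [x] be a Picard iterate, polynomial in [c], of the adjoint of the
   linearized equation with terminal value the [k]-th unit vector: the
   derivative of [x . e] is [h (x . D) + O(h^(2s+1))], and integrating it over [0, 1] gives
   the [k]-th component of the error at [h].  This dispenses with the flow's
   differentiability with respect to initial values. *)

Require Import Defs.
From HB Require Import structures.
From mathcomp Require Import all_boot all_order all_algebra.
From mathcomp Require Import all_classical all_reals all_analysis.
From mathcomp Require Import ring zify.

Set Implicit Arguments.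
Unset Strict Implicit.
Unset Printing Implicit Defensive.

Import Order.TTheory GRing.Theory Num.Theory.
Import numFieldNormedType.Exports.

Local Open Scope classical_set_scope.
Local Open Scope ring_scope.

(** * Integrals of polynomials, Legendre polynomials and Gauss quadrature *)

Section PolynomialIntegral.
Context {R : realType}.
Implicit Types p q : {poly R}.

(* The coefficient of index 0 is [p`_0 / 0 = 0]. *)
Definition primitive p : {poly R} := \poly_(i < (size p).+1) (p`_i.-1 / i%:R).

Lemma coef_primitive p i : (primitive p)`_i = p`_i.-1 / i%:R.
Proof.
rewrite coef_poly; case: ltnP => // pi; case: i pi => [//|i] /= pi.
by rewrite nth_default ?mul0r.
Qed.

Lemma size_primitive p : (size (primitive p) <= (size p).+1)%N.
Proof. exact: size_poly. Qed.

Lemma deriv_primitive p : (primitive p)^`() = p.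
Proof.
apply/polyP => i; rewrite coef_deriv coef_primitive /= -[LHS]mulr_natr.
by rewrite divfK // pnatr_eq0.
Qed.

Lemma primitive_horner0 p : (primitive p).[0] = 0.
Proof. by rewrite horner_coef0 coef_primitive invr0 mulr0. Qed.

Lemma is_derive_primitive p (x : R) :
  is_derive x (1 : R) (horner (primitive p)) p.[x].
Proof. by rewrite -[in p.[x]](deriv_primitive p); exact: is_derive_poly. Qed.

(** The fundamental theorem of calculus reduces the Lebesgue integral to algebra on coefficients;
    from here on integrals are handled through [primitive]. *)
Lemma integral_polyE (a b : R) p : a <= b ->
  Defs.integral_poly a b p = (primitive p).[b] - (primitive p).[a].
Proof.
rewrite /Defs.integral_poly /Rintegral le_eqVlt => /predU1P[<-|ab].
  by rewrite set_itv1 integral_set1 subrr.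
rewrite (@continuous_FTC2 _ _ (horner (primitive p))) //.
- exact/continuous_subspaceT/continuous_horner.
- split => [x _||].
  + by case: (is_derive_primitive p x).
  + exact/cvg_at_right_filter/continuous_horner.
  + exact/cvg_at_left_filter/continuous_horner.
- by move=> x _; rewrite derive1E; case: (is_derive_primitive p x).
Qed.

Lemma primitive_is_linear : linear primitive.
Proof.
move=> a p q; apply/polyP => i.
by rewrite !(coefD, coefZ, coef_primitive) mulrDl mulrA.
Qed.

HB.instance Definition _ := GRing.isLinear.Build R {poly R} {poly R} _
  primitive primitive_is_linear.

Definition int01 p : R := Defs.integral_poly 0 1 p.

Lemma int01E p : int01 p = (primitive p).[1].
Proof. by rewrite /int01 integral_polyE // primitive_horner0 subr0. Qed.

Lemma int01_is_scalar : scalar int01.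
Proof.
by move=> a p q; rewrite !int01E primitive_is_linear hornerD hornerZ.
Qed.

HB.instance Definition _ :=
  GRing.isLinear.Build R {poly R} R _ int01 int01_is_scalar.

Lemma int01_ge0 p : (forall x, 0 <= x <= 1 -> 0 <= p.[x]) -> 0 <= int01 p.
Proof.
move=> p0; rewrite /int01 /Defs.integral_poly; apply: Rintegral_ge0 => x /=.
by rewrite in_itv /=; exact: p0.
Qed.

End PolynomialIntegral.


Section Legendre.
Context {R : realType} (P : nat -> {poly R}).
Hypothesis P_legendre : legendre_basis P.
Implicit Types p q : {poly R}.

Lemma size_legendre i : size (P i) = i.+1.
Proof. by have [_ ->] := P_legendre. Qed.

Lemma int01_legendre i j : int01 (P i * P j) = (i == j)%:R.
Proof. by have [_ _ Pij] := P_legendre; exact: Pij. Qed.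

(** Since [P n] has degree exactly [n], subtracting a multiple of it cancels the coefficient of
    index [n], and induction applies to the rest. *)
Lemma legendre_span n p : (size p <= n)%N ->
  exists a : nat -> R, p = \sum_(i < n) a i *: P i.
Proof.
elim: n p => [|n IHn] p pn.
  exists (fun=> 0); rewrite big_ord0; apply/eqP.
  by rewrite -size_poly_eq0 -leqn0.
have P0 : lead_coef (P n) != 0.
  by rewrite lead_coef_eq0 -size_poly_eq0 size_legendre.
pose b := p`_n / lead_coef (P n).
have [|a pa] := IHn (p - b *: P n).
  apply/leq_sizeP => j; rewrite leq_eqVlt coefB coefZ => /predU1P[<-|nj].
    have -> : (P n)`_n = lead_coef (P n) by rewrite lead_coefE size_legendre.
    by rewrite divfK ?subrr.
  by rewrite !nth_default ?mulr0 ?subr0 ?size_legendre // (leq_trans pn).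
exists (fun i => if i == n then b else a i).
rewrite big_ord_recr /= eqxx; apply/eqP; rewrite -subr_eq pa; apply/eqP.
by apply: eq_bigr => i _; rewrite ltn_eqF.
Qed.

Lemma int01_legendre_lt i p : (size p <= i)%N -> int01 (P i * p) = 0.
Proof.
move=> /legendre_span[a ->]; rewrite mulr_sumr linear_sum big1 // => j _.
by rewrite -scalerAr linearZ /= int01_legendre gtn_eqF ?mulr0.
Qed.

(** Parseval: by orthonormality the integral is the sum of the squared Legendre coefficients, which
    do not all vanish. *)
Lemma int01_sqr_gt0 p : p != 0 -> 0 < int01 (p * p).
Proof.
have [a] := @legendre_span _ p (leqnn _); move: (size p) => n pa.
have -> : int01 (p * p) = \sum_(i < n) a i ^+ 2.
  rewrite pa mulr_suml linear_sum; apply: eq_bigr => i _.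
  rewrite mulr_sumr linear_sum (bigD1 i) //= big1 ?addr0 => [|j ji].
    rewrite -scalerAr -scalerAl linearZ /= linearZ /= int01_legendre eqxx.
    by rewrite mulr1.
  rewrite -scalerAr -scalerAl linearZ /= linearZ /= int01_legendre.
  by rewrite -val_eqE eq_sym /= in ji; rewrite (negbTE ji) !mulr0.
rewrite lt_def sumr_ge0 ?andbT => [|i _]; last exact: sqr_ge0.
apply: contra_neq => /psumr_eq0P a0.
rewrite pa big1 // => i _.
by have /eqP := a0 (fun i _ => sqr_ge0 _) i isT; rewrite sqrf_eq0 => /eqP ->;
  rewrite scale0r.
Qed.

(** Write [P k = q * ('X - c)]. Orthogonality of [P k] to [q] says that [c] is the mean of the
    variable for the weight [q * q] on the unit interval. Quadrature nodes thus lie where the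
    uniform estimates hold. *)
Lemma legendre_root_itv k c : root (P k) c -> 0 <= c <= 1.
Proof.
move=> /factor_theorem[q Pq].
have q0 : q != 0.
  apply/eqP => q0; move: (size_legendre k).
  by rewrite Pq q0 mul0r size_poly0.
have qk : (size q <= k)%N.
  move: (size_legendre k); rewrite Pq size_Mmonic ?monicXsubC // size_XsubC.
  by rewrite addn2 /= => -[->].
have Pq0 := int01_legendre_lt qk.
have qq0 := int01_sqr_gt0 q0.
have q_ge0 r : (forall x, 0 <= x <= 1 -> 0 <= r.[x]) ->
    0 <= int01 (r * (q * q)).
  move=> r0; apply: int01_ge0 => x x01.
  by rewrite !hornerM mulr_ge0 ?r0 // -expr2 sqr_ge0.
apply/andP; split; rewrite leNgt; apply/negP => c_out.
- have : 0 <= int01 ('X * (q * q)).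
    by apply: q_ge0 => x /andP[x0 _]; rewrite hornerX.
  have -> : 'X * (q * q) = P k * q + c *: (q * q).
    by rewrite Pq -mul_polyC; ring.
  by rewrite linearD linearZ /= Pq0 add0r leNgt pmulr_llt0 // c_out.
- have : 0 <= int01 ((1 - 'X) * (q * q)).
    by apply: q_ge0 => x /andP[_ x1]; rewrite !hornerE subr_ge0.
  have -> : (1 - 'X) * (q * q) = - (P k * q) + (1 - c) *: (q * q).
    by rewrite Pq -mul_polyC rmorphB; ring.
  rewrite linearD linearZ linearN /= Pq0 oppr0 add0r.
  by rewrite leNgt pmulr_llt0 // subr_lt0 c_out.
Qed.

Definition quadrature k (c b : 'I_k -> R) p : R := \sum_(l < k) b l * p.[c l].

Lemma quadrature_is_scalar k (c b : 'I_k -> R) : scalar (quadrature c b).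
Proof.
move=> a p q; rewrite /quadrature mulr_sumr -big_split /=.
by apply: eq_bigr => l _; rewrite hornerD hornerZ; ring.
Qed.

HB.instance Definition _ k (c b : 'I_k -> R) :=
  GRing.isLinear.Build R {poly R} R _ (quadrature c b)
    (quadrature_is_scalar c b).

(** Divide by [P k]: the quotient has degree below [k], so its product with [P k] integrates to
    zero, and it vanishes at the nodes. The remainder equals its Lagrange interpolant, which the
    weights integrate exactly. *)
Lemma quadrature_exact k (c b : 'I_k -> R) p : gauss_legendre P c b ->
  (size p <= k + k)%N -> quadrature c b p = int01 p.
Proof.
move=> [c_inj c_root bE] pk.
pose L l := \prod_(j < k | j != l) ((c l - c j)^-1 *: ('X - (c j)%:P)).
have interp (r : {poly R}) : (size r <= k)%N ->
    r = \sum_(l < k) r.[c l] *: L l.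
  move=> rk.
  have sL l : (size (L l) <= k)%N.
    apply: leq_trans (size_poly_prod_leq _ _) _.
    have -> : #|[pred j | j != l]| = k.-1 by rewrite cardC1 card_ord.
    rewrite leq_subLR.
    apply: (@leq_ltn_trans (\sum_(j < k | j != l) 2)).
      apply: leq_sum => j _; apply: leq_trans (size_scale_leq _ _) _.
      by rewrite size_XsubC.
    rewrite sum_nat_const cardC1 card_ord muln2 -addnn ltn_add2l.
    by rewrite ltn_predL (leq_ltn_trans _ (ltn_ord l)).
  have LE l i : (L l).[c i] = (i == l)%:R.
    rewrite /L horner_prod; have [->|il] := eqVneq i l.
      apply: big1 => j jl; rewrite !hornerE mulVf // subr_eq0.
      by rewrite (inj_eq c_inj) eq_sym.
    by rewrite (bigD1 i) //= !hornerE subrr mulr0 mul0r.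
  (* A nonzero difference of size at most [k] would have [k] distinct roots, the nodes. *)
  apply/eqP; rewrite -subr_eq0; apply/negPn/negP => r_neq0.
  have := max_poly_roots r_neq0 (rs := codom c).
  rewrite size_codom card_ord (map_inj_uniq c_inj) enum_uniq.
  have -> : all (root (r - \sum_(l < k) r.[c l] *: L l)) (codom c).
    apply/allP => _ /codomP[i ->]; rewrite /root !hornerE horner_sum.
    rewrite (bigD1 i) //= hornerZ LE eqxx mulr1 big1 ?addr0 ?subrr // => j ji.
    by rewrite hornerZ LE eq_sym (negbTE ji) mulr0.
  move=> /(_ isT isT); rewrite ltnNge => /negP; apply.
  apply: leq_trans (size_polyD _ _) _; rewrite size_polyN geq_max rk /=.
  apply: leq_trans (size_sum _ _ _) _; apply/bigmax_leqP => l _.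
  exact: leq_trans (size_scale_leq _ _) (sL l).
have quad_small (r : {poly R}) : (size r <= k)%N -> quadrature c b r = int01 r.
  move=> /interp rE; rewrite {2}rE linear_sum /quadrature.
  by apply: eq_bigr => l _; rewrite linearZ /= bE mulrC.
have P0 : P k != 0 by rewrite -size_poly_eq0 size_legendre.
rewrite (divp_eq p (P k)) !linearD /= [p %/ P k * P k]mulrC.
rewrite int01_legendre_lt; last first.
  by rewrite size_divp // size_legendre /= leq_subLR.
rewrite add0r (quad_small (p %% P k)); last first.
  by have := ltn_modpN0 p P0; rewrite size_legendre ltnS.
rewrite [X in X + _]big1 ?add0r // => l _.
by rewrite hornerM (rootP (c_root l)) mul0r mulr0.
Qed.

End Legendre.

(** * Uniform orders in the stepsize and graded polynomials *)

Section UniformO.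
Context {R : realType} (d : R).
Hypothesis d_le1 : d <= 1.
Implicit Types (F G : R -> R -> R) (a : R -> R) (p q : R -> {poly R}).

(* The remainders are functions of the stepsize [h] and of [c = t / h]. *)
Definition uniformO n F := exists C : R, forall h c : R,
  0 < h < d -> 0 <= c <= 1 -> `|F h c| <= C * h ^+ n.

Lemma uniformO_bound n F : uniformO n F -> exists2 C, 0 <= C &
  forall h c : R, 0 < h < d -> 0 <= c <= 1 -> `|F h c| <= C * h ^+ n.
Proof.
move=> [C FC]; exists `|C| => // h c hd c01.
apply: le_trans (FC _ _ hd c01) _; apply: ler_wpM2r (ler_norm _).
by case/andP: hd => h0 _; rewrite exprn_ge0 // ltW.
Qed.

Lemma eq_uniformO n F G :
  (forall h c : R, 0 < h < d -> 0 <= c <= 1 -> F h c = G h c) ->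
  uniformO n F -> uniformO n G.
Proof. by move=> FG [C FC]; exists C => h c hd c01; rewrite -FG // FC. Qed.

Lemma uniformO_le m n F : (m <= n)%N -> uniformO n F -> uniformO m F.
Proof.
move=> mn /uniformO_bound[C C0 FC]; exists C => h c hd c01.
apply: le_trans (FC _ _ hd c01) _; apply: ler_wpM2l => //.
by case/andP: hd => h0 hd; rewrite ler_wiXn2l // ltW // (lt_le_trans hd).
Qed.

Lemma uniformO_zero n F : (forall h c : R, 0 < h < d -> 0 <= c <= 1 -> F h c = 0) ->
  uniformO n F.
Proof. by move=> F0; exists 0 => h c hd c01; rewrite F0 // normr0 mul0r. Qed.

Lemma uniformO_cst (x : R) : uniformO 0 (fun _ _ => x).
Proof. by exists `|x| => h c _ _; rewrite mulr1. Qed.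

Lemma uniformO_exp n : uniformO n (fun h _ => h ^+ n).
Proof.
by exists 1 => h c /andP[h0 _] _; rewrite mul1r ger0_norm // exprn_ge0 // ltW.
Qed.

Lemma uniformO_id : uniformO 1 (fun h _ => h).
Proof. exact: (uniformO_exp 1). Qed.

Lemma uniformOD n F G :
  uniformO n F -> uniformO n G -> uniformO n (fun h c => F h c + G h c).
Proof.
move=> [C FC] [D GD]; exists (C + D) => h c hd c01.
by rewrite mulrDl (le_trans (ler_normD _ _)) // lerD ?FC ?GD.
Qed.

Lemma uniformON n F : uniformO n F -> uniformO n (fun h c => - F h c).
Proof. by move=> [C FC]; exists C => h c hd c01; rewrite normrN FC. Qed.

Lemma uniformOB n F G :
  uniformO n F -> uniformO n G -> uniformO n (fun h c => F h c - G h c).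
Proof. by move=> FO GO; apply: uniformOD => //; exact: uniformON. Qed.

Lemma uniformOM m n F G :
  uniformO m F -> uniformO n G -> uniformO (m + n) (fun h c => F h c * G h c).
Proof.
move=> /uniformO_bound[C C0 FC] /uniformO_bound[D D0 GD].
exists (C * D) => h c hd c01.
by rewrite exprD mulrACA normrM ler_pM ?FC ?GD.
Qed.

Lemma uniformOMl n F G :
  uniformO 0 F -> uniformO n G -> uniformO n (fun h c => F h c * G h c).
Proof. exact: uniformOM. Qed.

Lemma uniformOMr n F G :
  uniformO n F -> uniformO 0 G -> uniformO n (fun h c => F h c * G h c).
Proof. by move=> FO GO; rewrite -(addn0 n); exact: uniformOM. Qed.

Lemma uniformO_sum n (I : Type) (r : seq I) (F : I -> R -> R -> R) :
  (forall i, uniformO n (F i)) ->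
  uniformO n (fun h c => \sum_(i <- r) F i h c).
Proof.
move=> FO; elim: r => [|i r IHr].
  by apply: uniformO_zero => h c _ _; rewrite big_nil.
apply: eq_uniformO (uniformOD (FO i) IHr) => h c _ _.
by rewrite big_cons.
Qed.

Lemma uniformO_norm n F : uniformO n F -> uniformO n (fun h c => `|F h c|).
Proof. by move=> [C FC]; exists C => h c hd c01; rewrite normr_id FC. Qed.

Lemma uniformO_dominated n F G :
  (forall h c : R, 0 < h < d -> 0 <= c <= 1 -> `|F h c| <= G h c) ->
  uniformO n G -> uniformO n F.
Proof.
move=> FG [C GC]; exists C => h c hd c01.
apply: le_trans (FG _ _ hd c01) _; apply: le_trans (ler_norm _) _; exact: GC.
Qed.

Lemma uniformO_at n F (x : R) : 0 <= x <= 1 ->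
  uniformO n F -> uniformO n (fun h _ => F h x).
Proof. by move=> x01 [C FC]; exists C => h c hd _; exact: FC. Qed.

(** The mean value theorem on [[0, c]] with [c <= 1] keeps the constant. The power of [h] gained by
    integrating in time is a factor of [F'], because [c] is rescaled time. *)
Lemma uniformO_mean_value n F F' :
  (forall h : R, 0 < h < d -> F h 0 = 0) ->
  (forall h : R, 0 < h < d -> {within `[0, 1], continuous (F h)}) ->
  (forall h c : R, 0 < h < d -> 0 < c < 1 ->
     is_derive c (1 : R) (F h) (F' h c)) ->
  uniformO n F' -> uniformO n F.
Proof.
move=> F0 Fcont Fder /uniformO_bound[C C0 F'C]; exists C => h c hd.
have hn : 0 <= h ^+ n by case/andP: hd => h0 _; rewrite exprn_ge0 // ltW.
case/andP; rewrite le_eqVlt => /predU1P[<- _|c0 c1].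
  by rewrite F0 // normr0 mulr_ge0.
have [|| x] := @MVT R (F h) (F' h) 0 c c0.
- move=> x; rewrite in_itv /= => /andP[x0 xc].
  by apply: Fder => //; rewrite x0 (lt_le_trans xc).
- apply: continuous_subspaceW (Fcont _ hd) => x /=.
  by rewrite !in_itv /= => /andP[-> xc]; exact: le_trans xc c1.
rewrite in_itv /= => /andP[x0 xc]; rewrite F0 // !subr0 => ->.
rewrite normrM -[leRHS]mulr1 ler_pM //.
  by apply: F'C => //; rewrite ltW //= (le_trans (ltW xc)).
by rewrite ger0_norm // ltW.
Qed.

(* In the variable [t = c h] the coefficients of [p] of index at most [N] are
   bounded: [p] is a Taylor expansion of a smooth function of [t], up to
   [O(h^N)]. *)
Definition graded N p :=
  (exists M, forall h : R, 0 < h < d -> (size (p h) <= M)%N) /\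
  forall j, uniformO (minn j N) (fun h _ => (p h)`_j).

Lemma graded_le M N p : (M <= N)%N -> graded N p -> graded M p.
Proof.
move=> MN [sp pO]; split => // j; apply: uniformO_le (pO j).
by rewrite leq_min geq_minl (leq_trans (geq_minr _ _)).
Qed.

Lemma eq_graded N p q : (forall h : R, 0 < h < d -> p h = q h) ->
  graded N p -> graded N q.
Proof.
move=> pq [[M pM] pO]; split; first by exists M => h hd; rewrite -pq // pM.
by move=> j; apply: eq_uniformO (pO j) => h c hd _; rewrite pq.
Qed.

Lemma gradedD N p q : graded N p -> graded N q -> graded N (fun h => p h + q h).
Proof.
move=> [[M pM] pO] [[K qK] qO]; split.
  exists (maxn M K) => h hd; apply: leq_trans (size_polyD _ _) _.
  by rewrite geq_max !leq_max pM // qK // orbT.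
move=> j; apply: eq_uniformO (uniformOD (pO j) (qO j)) => h c _ _.
by rewrite coefD.
Qed.

(** The orders add up in the convolution: [minn j N <= minn i N + minn (j - i) N]. *)
Lemma gradedM N p q : graded N p -> graded N q -> graded N (fun h => p h * q h).
Proof.
move=> [[M pM] pO] [[K qK] qO]; split.
  exists (M + K)%N => h hd; apply: leq_trans (size_polyMleq _ _) _.
  by apply: leq_trans (leq_pred _) _; rewrite leq_add ?pM ?qK.
move=> j; apply: (@eq_uniformO _
  (fun h _ => \sum_(i < j.+1) (p h)`_i * (q h)`_(j - i))).
  by move=> h c _ _; rewrite coefM.
apply: uniformO_sum => i; apply: uniformO_le (uniformOM (pO i) (qO (j - i)%N)).
have ij : (i <= j)%N by rewrite -ltnS.
have : (j = i + (j - i))%N by rewrite subnKC.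
move: (j - i)%N => k; rewrite /minn.
by case: (ltnP i N) => ?; case: (ltnP k N) => ?; case: (ltnP j N) => ? ?; lia.
Qed.

Lemma gradedC N a : uniformO 0 (fun h _ => a h) -> graded N (fun h => (a h)%:P).
Proof.
move=> aO; split; first by exists 1%N => h _; exact: size_polyC_leq1.
case=> [|j].
  by rewrite min0n; apply: eq_uniformO aO => h c _ _; rewrite coefC.
by apply: uniformO_zero => h c _ _; rewrite coefC.
Qed.

Lemma graded0 N : graded N (fun=> 0).
Proof. by apply: eq_graded (gradedC N (uniformO_cst 0)). Qed.

Lemma gradedZ N a p : uniformO 0 (fun h _ => a h) -> graded N p ->
  graded N (fun h => a h *: p h).
Proof.
move=> aO pN; apply: eq_graded (gradedM (gradedC N aO) pN) => h _.
by rewrite mul_polyC.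
Qed.

Lemma gradedB N p q : graded N p -> graded N q -> graded N (fun h => p h - q h).
Proof.
move=> pN qN; apply: gradedD => //.
apply: eq_graded (gradedZ (uniformO_cst (-1)) qN) => h _.
by rewrite scaleN1r.
Qed.

(** The coefficients of [q] have index at most [i], so none asks for more than the order of [a]. It
    serves for Legendre sums, with [q = P i]. *)
Lemma graded_scale N i a (q : {poly R}) : (size q <= i.+1)%N ->
  uniformO (minn i N) (fun h _ => a h) -> graded N (fun h => a h *: q).
Proof.
move=> qi aO; split.
  by exists i.+1 => h _; apply: leq_trans (size_scale_leq _ _) qi.
move=> j; have [ij|ji] := leqP i.+1 j.
  apply: uniformO_zero => h c _ _.
  by rewrite coefZ nth_default ?mulr0 // (leq_trans qi).
apply: uniformO_le (_ : (minn j N <= minn i N)%N) _.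
  by rewrite leq_min geq_minr andbT (leq_trans (geq_minl _ _)).
apply: eq_uniformO (uniformOMr aO (uniformO_cst q`_j)) => h c _ _.
by rewrite coefZ.
Qed.

Lemma graded_cst (q : {poly R}) : graded 0 (fun=> q).
Proof.
split; first by exists (size q).
by move=> j; rewrite minn0; exact: uniformO_cst.
Qed.

Lemma graded_sum N (I : Type) (r : seq I) (p : I -> R -> {poly R}) :
  (forall i, graded N (p i)) -> graded N (fun h => \sum_(i <- r) p i h).
Proof.
move=> pN; elim: r => [|i r IHr].
  by apply: eq_graded (graded0 N) => h _; rewrite big_nil.
by apply: eq_graded (gradedD (pN i) IHr) => h _; rewrite big_cons.
Qed.

(** Integration in the time [c h]: the factor [h] pays for the shift of the index, and the
    truncation order rises with it. *)
Lemma graded_primitive N p : graded N p ->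
  graded N.+1 (fun h => h *: primitive (p h)).
Proof.
move=> [[M pM] pO]; split.
  exists M.+1 => h hd; apply: leq_trans (size_scale_leq _ _) _.
  by apply: leq_trans (size_primitive _) _; rewrite ltnS pM.
case=> [|j].
  by apply: uniformO_zero => h c _ _; rewrite coefZ coef_primitive invr0 !mulr0.
rewrite minnSS -add1n.
have := uniformOM uniformO_id (uniformOMr (pO j) (uniformO_cst j.+1%:R^-1)).
by apply: eq_uniformO => h c _ _; rewrite coefZ coef_primitive.
Qed.

Lemma scalar_polyE (L : {poly R} -> R) (M : nat) (f : {poly R}) : scalar L ->
  (size f <= M)%N -> L f = \sum_(l < M) f`_l * L 'X^l.
Proof.
move=> Ls fM.
suff E (L' : {scalar {poly R}}) : L' f = \sum_(l < M) f`_l * L' 'X^l.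
  (* [L] is a bare function; a linear structure is packed on the spot. *)
  exact: E (HB.pack L (GRing.isLinear.Build R {poly R} R _ L Ls)).
rewrite -[in LHS](coefK f) poly_def linear_sum /=.
under eq_bigr do rewrite linearZ /=.
rewrite (big_ord_widen _ (fun l => f`_l * L' 'X^l) fM) big_mkcond /=.
apply: eq_bigr => i _; case: ifPn => //; rewrite -leqNgt => fi.
by rewrite nth_default // mul0r.
Qed.

(** A functional that kills the monomials of degree below [n] only sees coefficients that are
    [O(h^n)]. In this way exactness and orthogonality turn into powers of [h]. *)
Lemma uniformO_scalar n N (L : R -> {poly R} -> R) p :
  (forall c, scalar (L c)) -> (forall l, uniformO 0 (fun _ c => L c 'X^l)) ->
  (forall l c, (l < n)%N -> L c 'X^l = 0) -> (n <= N)%N -> graded N p ->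
  uniformO n (fun h c => L c (p h)).
Proof.
move=> Ls LO L0 nN [[M pM] pO].
apply: (@eq_uniformO _ (fun h c => \sum_(l < M) (p h)`_l * L c 'X^l)).
  by move=> h c hd _; rewrite -scalar_polyE // pM.
apply: uniformO_sum => l; have [ln|nl] := ltnP l n.
  by apply: uniformO_zero => h c _ _; rewrite L0 // mulr0.
by apply: uniformO_le (uniformOMr (pO l) (LO l)); rewrite leq_min nl.
Qed.

Lemma uniformO_form n N (L : {poly R} -> R) p :
  scalar L -> (forall l, (l < n)%N -> L 'X^l = 0) -> (n <= N)%N -> graded N p ->
  uniformO n (fun h _ => L (p h)).
Proof.
move=> Ls L0 nN pN; apply: (@uniformO_scalar n N (fun=> L)) => // [l|l _].
  exact: uniformO_cst.
exact: L0.
Qed.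

(** Same mechanism with two arguments: for the surviving pairs of monomials, the orders of the two
    coefficients add up to at least [n]. *)
Lemma uniformO_bilinear n N (B : {poly R} -> {poly R} -> R) p q :
  (forall g, scalar (B g)) -> (forall g, scalar (B^~ g)) ->
  (forall l m, (l + m < n)%N -> B 'X^l 'X^m = 0) -> (n <= N)%N ->
  graded N p -> graded N q -> uniformO n (fun h _ => B (p h) (q h)).
Proof.
move=> Br Bl B0 nN [[M pM] pO] [[K qK] qO].
apply: (@eq_uniformO _ (fun h _ =>
    \sum_(l < M) \sum_(m < K) (p h)`_l * (q h)`_m * B 'X^l 'X^m)).
  move=> h c hd _; rewrite (scalar_polyE (Bl (q h)) (pM h hd)).
  apply: eq_bigr => l _; rewrite (scalar_polyE (Br 'X^l) (qK h hd)) mulr_sumr.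
  by apply: eq_bigr => m _; rewrite mulrA.
apply: uniformO_sum => l; apply: uniformO_sum => m.
have [lm|lm] := ltnP (l + m) n.
  by apply: uniformO_zero => h c _ _; rewrite B0 // mulr0.
apply: uniformOMr (uniformO_cst _).
apply: uniformO_le (uniformOM (pO l) (qO m)); move: lm; rewrite /minn.
by case: (ltnP l N) => ?; case: (ltnP m N) => ?; lia.
Qed.

Lemma graded_horner N p : graded N p -> uniformO 0 (fun h c => (p h).[c]).
Proof.
apply: (@uniformO_scalar 0 N (fun c f => f.[c])) => // [c x f g|l].
  by rewrite hornerD hornerZ.
exists 1 => h c _ /andP[c0 c1]; rewrite hornerXn mul1r ger0_norm ?exprn_ge0 //.
by rewrite exprn_ile1.
Qed.

Definition approx N F := exists2 p, graded N p &
  uniformO N (fun h c => F h c - (p h).[c]).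

Lemma approx_uniformO N F : approx N F -> uniformO 0 F.
Proof.
move=> [p pN /(uniformO_le (leq0n _)) FO].
apply: eq_uniformO (uniformOD FO (graded_horner pN)) => h c _ _.
by rewrite subrK.
Qed.

Lemma approx_graded N p : graded N p -> approx N (fun h c => (p h).[c]).
Proof.
by move=> pN; exists p => //; apply: uniformO_zero => h c _ _; rewrite subrr.
Qed.

Lemma approxM N F G : approx N F -> approx N G ->
  approx N (fun h c => F h c * G h c).
Proof.
move=> FN GN; have FO := approx_uniformO FN.
move: FN GN => [p pN Fp] [q qN Gq]; exists (fun h => p h * q h).
  exact: gradedM.
have qO := graded_horner qN.
apply: eq_uniformO (uniformOD (uniformOMl FO Gq) (uniformOMr Fp qO)) => h c _ _.
by rewrite hornerM; ring.
Qed.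

Lemma approx0 F : uniformO 0 F -> approx 0 F.
Proof.
move=> FO; exists (fun=> 0); first exact: graded0.
by apply: eq_uniformO FO => h c _ _; rewrite horner0 subr0.
Qed.

Lemma approx_choice N (I : Type) (F : I -> R -> R -> R) :
  (forall i, approx N (F i)) -> exists p : I -> R -> {poly R},
  (forall i, graded N (p i)) /\
  forall i, uniformO N (fun h c => F i h c - (p i h).[c]).
Proof.
move=> FN.
have /choice[p pF] : forall i, exists p, graded N p /\
    uniformO N (fun h c => F i h c - (p h).[c]).
  by move=> i; have [p] := FN i; exists p.
by exists p; split => i; case: (pF i).
Qed.

Lemma approx_sum N (I : Type) (r : seq I) (F : I -> R -> R -> R) :
  (forall i, approx N (F i)) -> approx N (fun h c => \sum_(i <- r) F i h c).
Proof.
move=> /approx_choice[p [pN pF]].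
exists (fun h => \sum_(i <- r) p i h); first exact: graded_sum.
apply: (@eq_uniformO _ (fun h c => \sum_(i <- r) (F i h c - (p i h).[c]))).
  by move=> h c _ _; rewrite horner_sum sumrB.
exact: uniformO_sum.
Qed.

End UniformO.

(** * Bounded partial derivatives on a set *)

Section Regularity.
Context {R : realType} {m : nat} (K : set 'cV[R]_m).
Implicit Types (f : 'cV[R]_m -> R) (G : 'I_m -> 'cV[R]_m -> R).

(** The chain rule is taken as the definition of partial derivatives, so sums and products inherit
    it from the rules in one variable. *)
Definition has_partials f G := forall (w : R -> 'cV[R]_m) (w' : 'I_m -> R) (c : R),
  K (w c) -> (forall b, is_derive c (1 : R) (fun t => w t b ord0) (w' b)) ->
  is_derive c (1 : R) (fun t => f (w t)) (\sum_b G b (w c) * w' b).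

(* On [K], [f] is bounded together with its partial derivatives up to order [n];
   the derivatives enter only through the chain rule along curves. *)
Fixpoint regular n f : Prop :=
  (exists C : R, forall x, K x -> `|f x| <= C) /\
  if n is n'.+1 then
    exists2 G, has_partials f G & forall b, regular n' (G b)
  else True.

Lemma regular_bounded n f : regular n f -> exists C : R, forall x, K x -> `|f x| <= C.
Proof. by case: n => [|n] []. Qed.

Lemma regularS n f : regular n.+1 f ->
  exists2 G, has_partials f G & forall b, regular n (G b).
Proof. by case. Qed.

Lemma regular_le k n f : (k <= n)%N -> regular n f -> regular k f.
Proof.
elim: n k f => [|n IHn] [|k] f //=; first by move=> _ [].
by rewrite ltnS => kn [fK [G fG Gn]]; split=> //; exists G => // b; exact: IHn.
Qed.

Lemma Ck_bounded p q (U : set 'cV[R]_m) n (F : 'cV[R]_m -> 'M[R]_(p, q)) i j :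
  compact K -> K `<=` U -> Ck n U F ->
  exists C : R, forall x, K x -> `|F x i j| <= C.
Proof.
move=> Kc KU CF.
have Fc x : K x -> {for x, continuous F}.
  move=> /KU Ux; case: n CF => [|n] /= CF; first exact: CF.
  by apply: differentiable_continuous; case: CF => + _; apply.
have Fijc : {within K, continuous (fun x => F x i j)}.
  apply: continuous_in_subspaceT => x; rewrite inE => Kx.
  apply: (@continuous_comp _ _ _ F (fun M => M i j) x); first exact: Fc.
  exact: coord_continuous.
have [M [_ MK]] := compact_bounded (continuous_compact Fijc Kc).
exists (M + 1) => x Kx; apply: (MK (M + 1)); first by rewrite ltrDl.
by exists x.
Qed.

(** Continuity on the compact [K] gives the bounds, and the derivatives along basis vectors are of
    class [Ck] with one order less. *)
Lemma Ck_regular p q (U : set 'cV[R]_m) n (F : 'cV[R]_m -> 'M[R]_(p, q)) i j :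
  compact K -> K `<=` U -> Ck n U F -> regular n (fun x => F x i j).
Proof.
move=> Kc KU; elim: n F => [|n IHn] F CF.
  by split=> //; exact: Ck_bounded CF.
split; first exact: Ck_bounded CF.
case: CF => dF CF.
exists (fun b x => 'D_(delta_mx b ord0) F x i j); last first.
  by move=> b; exact: (IHn _ (CF _)).
move=> w w' c Kw dw.
have dwc : derivable w c 1.
  by apply/derivable_mxP => a b; rewrite ord1; case: (dw a).
(* Expanding the velocity in the standard basis lets linearity of the differential of [F] produce
   the partial derivatives. *)
have wc' : 'd w c 1 = \sum_b w' b *: delta_mx b ord0.
  rewrite -deriveE; last exact/derivable1_diffP.
  rewrite derive_mx //; apply/matrixP => a b; rewrite ord1 !mxE.
  rewrite summxE (bigD1 a) //= big1 ?addr0 => [|k ka].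
    by rewrite !mxE !eqxx mulr1; case: (dw a).
  by rewrite !mxE eq_sym (negbTE ka) mulr0.
have dFw : differentiable (F \o w) c.
  apply: differentiable_comp; first exact/derivable1_diffP.
  exact/dF/KU.
have dFw1 : derivable (F \o w) c 1 by apply/derivable1_diffP.
have FwE : 'D_1 (F \o w) c i j = 'D_1 (fun t => F (w t) i j) c.
  by rewrite derive_mx // mxE.
apply: DeriveDef; first by have /derivable_mxP := dFw1; apply.
rewrite -FwE deriveE // diff_comp; [|exact/derivable1_diffP|exact/dF/KU].
rewrite /= wc' linear_sum summxE; apply: eq_bigr => b _.
by rewrite linearZ /= deriveE ?mxE 1?mulrC //; exact/dF/KU.
Qed.

Lemma is_derive_sum_fun (I : Type) (r : seq I) (F : I -> R -> R) (dF : I -> R)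
  (c : R) : (forall i, is_derive c (1 : R) (F i) (dF i)) ->
  is_derive c (1 : R) (fun t => \sum_(i <- r) F i t) (\sum_(i <- r) dF i).
Proof.
move=> dFi; elim: r => [|i r IHr].
  rewrite big_nil; have -> : (fun t => \sum_(i <- [::]) F i t) = cst 0.
    by apply/funext => t; rewrite big_nil.
  exact: is_derive_cst.
rewrite big_cons.
have -> : (fun t => \sum_(j <- i :: r) F j t) = F i + (fun t => \sum_(j <- r) F j t).
  by apply/funext => t; rewrite big_cons.
exact: is_deriveD.
Qed.

Lemma regular_cst n (x : R) : regular n (fun=> x).
Proof.
elim: n x => [|n IHn] x; (split; first by exists `|x|) => //.
exists (fun _ _ => 0) => [w w' c _ _|b]; last exact: IHn.
by rewrite big1 => [|b _]; [exact: is_derive_cst|rewrite mul0r].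
Qed.

Lemma regularD n f g : regular n f -> regular n g -> regular n (fun x => f x + g x).
Proof.
elim: n f g => [|n IHn] f g fn gn;
  have [C fC] := regular_bounded fn; have [D gD] := regular_bounded gn;
  (split; first by exists (C + D) => x Kx;
    rewrite (le_trans (ler_normD _ _)) ?lerD ?fC ?gD) => //.
have [F fF Fn] := regularS fn; have [G gG Gn] := regularS gn.
exists (fun b x => F b x + G b x) => [w w' c Kw dw|b]; last exact: IHn.
have := is_deriveD (fF _ _ _ Kw dw) (gG _ _ _ Kw dw).
by rewrite -big_split /=; under eq_bigr do rewrite -mulrDl.
Qed.

Lemma regularM n f g : regular n f -> regular n g -> regular n (fun x => f x * g x).
Proof.
elim: n f g => [|n IHn] f g fn gn;
  have [C fC] := regular_bounded fn; have [D gD] := regular_bounded gn;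
  (split; first by exists (C * D) => x Kx;
    rewrite normrM ler_pM ?fC ?gD) => //.
have [F fF Fn] := regularS fn; have [G gG Gn] := regularS gn.
exists (fun b x => f x * G b x + g x * F b x) => [w w' c Kw dw|b].
  apply: is_derive_eq; first exact: is_deriveM (fF _ _ _ Kw dw) (gG _ _ _ Kw dw).
  rewrite /GRing.scale /= !mulr_sumr -big_split /=.
  by apply: eq_bigr => b _; ring.
by apply: regularD; apply: IHn => //; exact: (@regular_le n n.+1).
Qed.

Lemma regular_sum n (I : Type) (r : seq I) (F : I -> 'cV[R]_m -> R) :
  (forall i, regular n (F i)) -> regular n (fun x => \sum_(i <- r) F i x).
Proof.
move=> Fn; elim: r => [|i r IHr].
  have -> : (fun x => \sum_(i <- [::]) F i x) = (fun=> 0).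
    by apply/funext => x; rewrite big_nil.
  exact: regular_cst.
have -> : (fun x => \sum_(j <- i :: r) F j x) = (fun x => F i x + \sum_(j <- r) F j x).
  by apply/funext => x; rewrite big_cons.
exact: regularD.
Qed.

(** Mean value estimates need the whole segment, while [K] is an arbitrary set; the condition is
    therefore put on each pair of points. *)
Definition segment_in (x y : 'cV[R]_m) :=
  forall t : R, 0 <= t <= 1 -> K (x + t *: (y - x)).

Lemma segment_in_l x y : segment_in x y -> K x.
Proof. by move=> /(_ 0); rewrite scale0r addr0; apply; rewrite lexx ler01. Qed.

Lemma segment_in_sub x y (t : R) : segment_in x y -> 0 <= t <= 1 ->
  segment_in x (x + t *: (y - x)).
Proof.
move=> xy /andP[t0 t1] r /andP[r0 r1].
rewrite addrAC subrr add0r scalerA; apply: xy.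
by rewrite mulr_ge0 //= mulr_ile1.
Qed.

Lemma mean_value f G x y : has_partials f G -> segment_in x y ->
  exists2 t : R, 0 <= t <= 1 &
  f y - f x = \sum_b G b (x + t *: (y - x)) * (y b ord0 - x b ord0).
Proof.
move=> fG xy.
have fder (t : R) : 0 <= t <= 1 -> is_derive t (1 : R) (fun t => f (x + t *: (y - x)))
    (\sum_b G b (x + t *: (y - x)) * (y b ord0 - x b ord0)).
  move=> t01; apply: (fG (fun t => x + t *: (y - x))); first exact: xy.
  move=> b; have -> : (fun t => (x + t *: (y - x)) b ord0) =
      horner ((x b ord0)%:P + (y b ord0 - x b ord0) *: 'X).
    by apply/funext => r; rewrite !mxE !hornerE mulrC.
  by apply: is_derive_eq; rewrite derivD derivC derivZ derivX !hornerE.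
have [||t] := @MVT_segment R (fun t => f (x + t *: (y - x)))
  (fun t => \sum_b G b (x + t *: (y - x)) * (y b ord0 - x b ord0)) 0 1 ler01.
- by move=> t; rewrite in_itv /= => /andP[t0 t1]; apply: fder; rewrite !ltW.
- apply: derivable_within_continuous => t; rewrite in_itv /= => t01.
  by case: (fder t t01).
rewrite in_itv /= => t01; rewrite scale1r scale0r subr0 mulr1 addr0 subrKC => ->.
by exists t.
Qed.

Lemma regular_lipschitz f : regular 1 f -> exists2 C, 0 <= C & forall x y,
  segment_in x y -> `|f y - f x| <= C * \sum_b `|y b ord0 - x b ord0|.
Proof.
move=> /regularS[G fG Gb].
have [C CG] : exists C : R, forall b x, K x -> `|G b x| <= C.
  have /choice[C CG] : forall b, exists C : R, forall x, K x -> `|G b x| <= C.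
    by move=> b; exact: (@regular_bounded 0 _ (Gb b)).
  exists (\sum_b `|C b|) => b x Kx; apply: le_trans (CG _ _ Kx) _.
  apply: le_trans (ler_norm _) _.
  by rewrite (bigD1 b) //= lerDl sumr_ge0.
exists `|C| => // x y xy; have [t t01 ->] := mean_value fG xy.
apply: le_trans (ler_norm_sum _ _ _) _; rewrite mulr_sumr ler_sum // => b _.
rewrite normrM ler_wpM2r //; apply: le_trans (ler_norm _).
by apply: CG; exact: xy.
Qed.

(** The mean value theorem gives the derivatives at an intermediate point; their Lipschitz bound
    moves them to [x] at the price of a second factor. *)
Lemma regular_taylor2 f G : has_partials f G -> (forall b, regular 1 (G b)) ->
  exists C : R, forall x y, segment_in x y ->
  `|f y - f x - \sum_b G b x * (y b ord0 - x b ord0)|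
    <= C * (\sum_b `|y b ord0 - x b ord0|) ^+ 2.
Proof.
move=> fG Gb.
have /choice[C CG] : forall b, exists C, 0 <= C /\ forall x y,
    segment_in x y -> `|G b y - G b x| <= C * \sum_a `|y a ord0 - x a ord0|.
  by move=> b; have [C C0 CG] := regular_lipschitz (Gb b); exists C.
exists (\sum_b C b) => x y xy; have [t t01 ->] := mean_value fG xy.
rewrite -sumrB; apply: le_trans (ler_norm_sum _ _ _) _.
rewrite mulr_suml; apply: ler_sum => b _.
have [C0 {}CG] := CG b.
rewrite -mulrBl normrM expr2 mulrA ler_pM //.
  apply: le_trans (CG _ _ (segment_in_sub xy t01)) _.
  rewrite ler_wpM2l // ler_sum // => a _; rewrite !mxE addrAC subrr add0r.
  by case/andP: t01 => t0 t1; rewrite normrM ger0_norm // ler_piMl.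
by rewrite (bigD1 b) //= lerDl sumr_ge0.
Qed.

End Regularity.

(** * Composition with a graded curve *)

Section Composition.
Context {R : realType} (d : R).
Hypothesis d_le1 : d <= 1.

(** Derivative in the time [c h]: the index shift compensates [h^-1], and one order of truncation is
    lost. *)
Lemma graded_deriv N (p : R -> {poly R}) : graded d N.+1 p ->
  graded d N (fun h => h^-1 *: (p h)^`()).
Proof.
move=> [[M pM] pO]; split.
  exists M => h hd; apply: leq_trans (size_scale_leq _ _) _.
  by apply: leq_trans (size_poly _ _) _; rewrite (leq_trans (leq_pred _)) ?pM.
move=> j; have [C pC] := pO j.+1; exists (C *+ j.+1) => h c hd c01.
have h0 : 0 < h by case/andP: hd.
rewrite coefZ coef_deriv normrM normrV ?unitfE ?gt_eqF // (ger0_norm (ltW h0)).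
rewrite mulrC ler_pdivrMr // normrMn !mulrnAl ler_pMn2r // -mulrA -exprSr.
by rewrite -minnSS; exact: (pC h c).
Qed.

Context {m : nat} (K : set 'cV[R]_m).

Lemma uniformO_regular n (f : 'cV[R]_m -> R) (w : R -> R -> 'cV[R]_m) :
  regular K n f -> (forall h c : R, 0 < h < d -> 0 <= c <= 1 -> K (w h c)) ->
  uniformO d 0 (fun h c => f (w h c)).
Proof.
move=> /regular_bounded[C fC] wK; exists C => h c hd c01; rewrite mulr1.
exact/fC/wK.
Qed.

Definition pcurve (v : 'I_m -> R -> {poly R}) (h c : R) : 'cV[R]_m :=
  \col_b (v b h).[c].

Lemma is_derive_pcurve f G v h c : has_partials K f G -> K (pcurve v h c) ->
  is_derive c (1 : R) (fun c => f (pcurve v h c))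
    (\sum_b G b (pcurve v h c) * ((v b h)^`()).[c]).
Proof.
move=> fG Kc; apply: (fG (pcurve v h)) => // b.
have -> : (fun t => pcurve v h t b ord0) = horner (v b h).
  by apply/funext => t; rewrite mxE.
exact: is_derive_poly.
Qed.

(* One derivative of [f] is spent per order: [(f o v)' = \sum_b (d_b f o v) v_b']
   is [h] times an expansion of order [N]. *)
Lemma approx_comp N f v : regular K N f -> (forall b, graded d N (v b)) ->
  (forall h c : R, 0 < h < d -> 0 <= c <= 1 -> K (pcurve v h c)) ->
  approx d N (fun h c => f (pcurve v h c)).
Proof.
elim: N f v => [|N IHN] f v fN vN vK.
  by apply: approx0; exact: uniformO_regular fN vK.
have [G fG GN] := regularS fN.
pose q b h := h^-1 *: (v b h)^`().
have [p pN Dp] : approx d N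
    (fun h c => \sum_b G b (pcurve v h c) * (q b h).[c]).
  apply: approx_sum => // b; apply: approxM => //.
    by apply: (IHN _ _ (GN b)) => // a; apply: graded_le (vN a).
  exact/approx_graded/graded_deriv.
(* The initial value plus the time integral of the expansion [p] of the derivative. *)
exists (fun h => (f (pcurve v h 0))%:P + h *: primitive (p h)).
  apply: gradedD => //; last exact: graded_primitive.
  apply: gradedC => //.
  by apply: (uniformO_at _ (uniformO_regular fN vK)); rewrite lexx ler01.
have der (h c : R) : 0 < h < d -> 0 <= c <= 1 ->
    is_derive c (1 : R) (fun c => f (pcurve v h c) -
      ((f (pcurve v h 0))%:P + h *: primitive (p h)).[c])
    (h * (\sum_b G b (pcurve v h c) * (q b h).[c] - (p h).[c])).
  move=> hd c01; have fv := is_derive_pcurve fG (vK _ _ hd c01).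
  apply: is_derive_eq.
  rewrite derivD derivC derivZ deriv_primitive add0r hornerZ mulrBr.
  congr (_ - _); rewrite mulr_sumr; apply: eq_bigr => b _.
  rewrite /q hornerZ mulrCA mulVKf //.
  by case/andP: hd => h0 _; rewrite gt_eqF.
apply: (uniformO_mean_value _ _ (F' := fun h c => h *
  (\sum_b G b (pcurve v h c) * (q b h).[c] - (p h).[c]))).
- by move=> h hd; rewrite !hornerE primitive_horner0 mulr0 addr0 subrr.
- move=> h hd; apply: derivable_within_continuous => c.
  by rewrite in_itv /= => c01; case: (der h c hd c01).
- by move=> h c hd /andP[c0 c1]; apply: der; rewrite ?ltW.
- by rewrite -add1n; apply: uniformOM => //; exact: uniformO_id.
Qed.

End Composition.

(** * Legendre projection of graded polynomials *)

Section Projection.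
Context {R : realType} (P : nat -> {poly R}) (s : nat).
Hypothesis P_legendre : legendre_basis P.
Implicit Types f g : {poly R}.

Definition proj f : {poly R} := \sum_(i < s) int01 (P i * f) *: P i.

Lemma proj_is_linear : linear proj.
Proof.
move=> a f g; rewrite /proj scaler_sumr -big_split /=; apply: eq_bigr => i _.
by rewrite mulrDr -scalerAr linearD linearZ /= scalerDl scalerA.
Qed.

HB.instance Definition _ :=
  GRing.isLinear.Build R {poly R} {poly R} _ proj proj_is_linear.

Lemma proj_orthogonal f g : (size g <= s)%N -> int01 ((f - proj f) * g) = 0.
Proof.
move=> /(legendre_span P_legendre)[a ->].
rewrite mulr_sumr linear_sum big1 // => j _.
rewrite -scalerAr linearZ /= mulrBl linearB /= mulr_suml linear_sum /=.
rewrite (bigD1 j) //= big1 ?addr0 => [|i ij].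
  rewrite -scalerAl linearZ /= int01_legendre // eqxx mulr1 [f * _]mulrC.
  by rewrite subrr mulr0.
rewrite -scalerAl linearZ /= int01_legendre //.
by rewrite -val_eqE /= in ij; rewrite (negbTE ij) mulr0.
Qed.

Lemma proj_id f : (size f <= s)%N -> proj f = f.
Proof.
move=> /(legendre_span P_legendre)[a ->].
rewrite linear_sum; apply: eq_bigr => j _; rewrite linearZ /=; congr (_ *: _).
rewrite /proj (bigD1 j) //= big1 ?addr0 => [|i ij].
  by rewrite int01_legendre // eqxx scale1r.
by rewrite -val_eqE /= in ij; rewrite int01_legendre // (negbTE ij) scale0r.
Qed.

Context (d : R).
Hypothesis d_le1 : d <= 1.
Implicit Types p q : R -> {poly R}.

Lemma uniformO_legendre N i p : graded d N p ->
  uniformO d (minn i N) (fun h _ => int01 (P i * p h)).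
Proof.
apply: (uniformO_form d_le1 (L := fun f => int01 (P i * f))) => [a f g|l li|].
- by rewrite mulrDr -scalerAr linearD linearZ.
- rewrite int01_legendre_lt // size_polyXn.
  by apply: leq_trans li (geq_minl _ _).
- exact: geq_minr.
Qed.

(** For [l < i < k] the product [P i * 'X^l] is integrated exactly, so the quadrature annihilates it
    as the integral does. *)
Lemma uniformO_quadrature_legendre k (c b : 'I_k -> R) N i p :
  gauss_legendre P c b -> (i < k)%N -> graded d N p ->
  uniformO d (minn i N) (fun h _ => quadrature c b (P i * p h)).
Proof.
move=> cb ik.
apply: (uniformO_form d_le1 (L := fun f => quadrature c b (P i * f))) => [a f g|l li|].
- by rewrite mulrDr -scalerAr linearD linearZ.
- have {}li : (l < i)%N by apply: leq_trans li (geq_minl _ _).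
  rewrite (quadrature_exact P_legendre cb).
    by rewrite int01_legendre_lt // size_polyXn.
  apply: leq_trans (size_polyMleq _ _) _.
  by rewrite size_legendre // size_polyXn; lia.
- exact: geq_minr.
Qed.

Lemma uniformO_quadrature_error k (c b : 'I_k -> R) N p :
  gauss_legendre P c b -> (s <= k)%N -> (s + s <= N)%N -> graded d N p ->
  uniformO d (s + s) (fun h _ => quadrature c b (p h) - int01 (p h)).
Proof.
move=> cb sk; apply: (uniformO_form d_le1
    (L := fun f => quadrature c b f - int01 f)) => [a f g|l li].
  by rewrite quadrature_is_scalar int01_is_scalar; ring.
rewrite (quadrature_exact P_legendre cb) ?subrr // size_polyXn.
by apply: leq_trans li _; rewrite leq_add.
Qed.

Lemma graded_proj N p : graded d N p -> graded d N (fun h => proj (p h)).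
Proof.
move=> pN; apply: graded_sum => i; apply: (@graded_scale _ _ d_le1 _ i).
  by rewrite size_legendre.
exact: uniformO_legendre.
Qed.

(** If [l + m < 2 s], one of the degrees is below [s]: either the first monomial is its own
    projection, or the second is orthogonal to the projection error. *)
Lemma uniformO_proj_orthogonal N p q : (s + s <= N)%N ->
  graded d N p -> graded d N q ->
  uniformO d (s + s) (fun h _ => int01 ((p h - proj (p h)) * q h)).
Proof.
apply: (uniformO_bilinear d_le1 (B := fun f g => int01 ((f - proj f) * g))).
- by move=> g a f1 f2; rewrite mulrDr -scalerAr linearD linearZ.
- move=> g a f1 f2; rewrite linearD linearZ /= opprD addrACA -scalerBr.
  by rewrite mulrDl -scalerAl linearD linearZ.
- move=> l k lk; have [ls|sl] := leqP l.+1 s.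
    by rewrite proj_id ?size_polyXn // subrr mul0r linear0.
  by rewrite proj_orthogonal // size_polyXn; lia.
Qed.

Lemma uniformO_proj_error N p : (s <= N)%N -> graded d N p ->
  uniformO d s (fun h c => (p h - proj (p h)).[c]).
Proof.
apply: (uniformO_scalar d_le1 (L := fun c f => (f - proj f).[c])).
- move=> c a f g; rewrite linearD linearZ /= opprD addrACA -scalerBr.
  by rewrite [LHS]hornerD hornerZ.
- move=> l; exact: (graded_horner d_le1 (graded_cst d ('X^l - proj 'X^l))).
- by move=> l c ls; rewrite proj_id ?subrr ?horner0 // size_polyXn.
Qed.

(* Both errors are [O(h^(2s))]: the one of the quadrature by exactness up to
   degree [2s - 1], the one of the projection because [z - proj z] is [O(h^s)]
   and orthogonal to the part of [F] that is not [O(h^s)]. *)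
Lemma uniformO_discrete_projection k (c b : 'I_k -> R) N z F (a : nat -> R -> R) :
  gauss_legendre P c b -> (s <= k)%N -> (s + s <= N)%N ->
  graded d N z -> graded d N F ->
  (forall i, (i < s)%N ->
     uniformO d N (fun h _ => a i h - quadrature c b (P i * F h))) ->
  uniformO d (s + s)
    (fun h _ => int01 (z h * \sum_(i < s) a i h *: P i) - int01 (z h * F h)).
Proof.
move=> cb sk sN zN FN aO.
(* Three errors: [a] against the quadratures it approximates ([E1]), quadrature against integral of
   [proj z * F] ([E2]), and [z - proj z] integrated against [F] ([E3]). *)
have E1 : uniformO d (s + s) (fun h _ => \sum_(i < s)
    (a i h - quadrature c b (P i * F h)) * int01 (P i * z h)).
  apply: uniformO_sum => i; apply: uniformOMr.
    exact: (uniformO_le d_le1 sN (aO i (ltn_ord i))).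
  exact: (uniformO_le d_le1 (leq0n _) (uniformO_legendre i zN)).
have E2 := uniformO_quadrature_error cb sk sN
  (gradedM d_le1 (graded_proj zN) FN).
have E3 := uniformO_proj_orthogonal sN zN FN.
apply: eq_uniformO (uniformOB (uniformOD E1 E2) E3) => h c' hd _.
have -> : int01 (z h * \sum_(i < s) a i h *: P i) =
    \sum_(i < s) a i h * int01 (P i * z h).
  rewrite mulr_sumr linear_sum; apply: eq_bigr => i _.
  by rewrite -scalerAr linearZ /= [z h * _]mulrC.
have -> : quadrature c b (proj (z h) * F h) =
    \sum_(i < s) int01 (P i * z h) * quadrature c b (P i * F h).
  rewrite mulr_suml linear_sum; apply: eq_bigr => i _.
  by rewrite -scalerAl linearZ.
have -> : \sum_(i < s) (a i h - quadrature c b (P i * F h)) * int01 (P i * z h) =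
    \sum_(i < s) a i h * int01 (P i * z h) -
    \sum_(i < s) int01 (P i * z h) * quadrature c b (P i * F h).
  by rewrite -sumrB; apply: eq_bigr => i _; ring.
by rewrite mulrBl linearB /=; ring.
Qed.

End Projection.

(** * Expansion of the line integral method *)

Section LineIntegral.
Context {R : realType} (d : R) {m : nat} (P : nat -> {poly R}) (s k1 k2 : nat).
Hypotheses (d_le1 : d <= 1) (P_legendre : legendre_basis P).
Context (c1 b1 : 'I_k1 -> R) (c2 b2 : 'I_k2 -> R).
Hypotheses (gauss1 : gauss_legendre P c1 b1) (gauss2 : gauss_legendre P c2 b2).
Hypotheses (s_le_k1 : (s <= k1)%N) (s_le_k2 : (s <= k2)%N).
Context (Sf : 'I_m -> 'I_m -> 'cV[R]_m -> R) (g : 'I_m -> 'cV[R]_m -> R).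
Context (y0 : 'I_m -> R) (Gam : nat -> 'I_m -> R -> R).

(* [Gam i a h] stands for the [a]-th component of the vector written
   Gamma-hat_i in the paper and [line_poly] for the polynomial [c |-> u (c h)]. *)
Definition line_poly b h : {poly R} :=
  (y0 b)%:P + h *: primitive (\sum_(i < s) Gam i b h *: P i).

Local Notation v := line_poly.

Definition line_gamma j b h : R :=
  \sum_(l < k2) b2 l * (P j).[c2 l] * g b (pcurve v h (c2 l)).

Definition line_system := forall i a (h : R), (i < s)%N -> 0 < h < d ->
  Gam i a h = \sum_(j < s) \sum_b
    (\sum_(l < k1) b1 l * (P i).[c1 l] * (P j).[c1 l] * Sf a b (pcurve v h (c1 l)))
    * line_gamma j b h.

Hypothesis GamE : line_system.

Section Expansion.
Context (N : nat) (sg : 'I_m -> 'I_m -> R -> {poly R}) (gg : 'I_m -> R -> {poly R}).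
Hypotheses (sgN : forall a b, graded d N (sg a b)) (ggN : forall b, graded d N (gg b)).
Hypothesis Sf_sg : forall a b,
  uniformO d N (fun h c => Sf a b (pcurve v h c) - (sg a b h).[c]).
Hypothesis g_gg : forall b,
  uniformO d N (fun h c => g b (pcurve v h c) - (gg b h).[c]).

Lemma gamma_expansion j b :
  uniformO d N (fun h _ => line_gamma j b h - quadrature c2 b2 (P j * gg b h)).
Proof.
apply: (@eq_uniformO _ _ _ (fun h _ => \sum_(l < k2) b2 l * (P j).[c2 l] *
    (g b (pcurve v h (c2 l)) - (gg b h).[c2 l]))).
  move=> h c _ _; rewrite /quadrature /line_gamma -sumrB.
  by apply: eq_bigr => l _; rewrite hornerM; ring.
apply: uniformO_sum => l; apply: uniformOMl; first exact: uniformO_cst.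
apply: (uniformO_at (legendre_root_itv P_legendre _) (g_gg b)).
by case: gauss2 => _ + _; apply.
Qed.

Lemma gammaO j b : (j < s)%N -> uniformO d (minn j N) (fun h _ => line_gamma j b h).
Proof.
move=> js; have jk2 : (j < k2)%N by apply: leq_trans js s_le_k2.
apply: eq_uniformO (uniformOD (uniformO_le d_le1 (geq_minr _ _) (gamma_expansion j b))
  (uniformO_quadrature_legendre P_legendre d_le1 gauss2 jk2 (ggN b))).
by move=> h c _ _; rewrite subrK.
Qed.

(* As the exact Legendre expansion truncated at [s], but with the coefficients
   computed by the quadrature. *)
Definition gamma_poly b h : {poly R} := \sum_(j < s) line_gamma j b h *: P j.

Lemma graded_gamma_poly b : graded d N (gamma_poly b).
Proof.
apply: graded_sum => j; apply: (@graded_scale _ _ d_le1 _ j).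
  by rewrite size_legendre.
exact: gammaO.
Qed.

Definition force_poly a h : {poly R} := \sum_b sg a b h * gamma_poly b h.

Lemma graded_force_poly a : graded d N (force_poly a).
Proof.
by apply: graded_sum => b; apply: gradedM => //; exact: graded_gamma_poly.
Qed.

(** Summing over [j] inside the quadrature rebuilds [gamma_poly] at the nodes; it then remains to
    replace [Sf] by its expansion there. *)
Lemma Gam_expansion i a : (i < s)%N -> uniformO d N
  (fun h _ => Gam i a h - quadrature c1 b1 (P i * force_poly a h)).
Proof.
move=> si; apply: (@eq_uniformO _ _ _ (fun h _ => \sum_(l < k1) \sum_b
    (b1 l * (P i).[c1 l]) * ((Sf a b (pcurve v h (c1 l)) - (sg a b h).[c1 l]) *
      (gamma_poly b h).[c1 l]))).
  move=> h c hd _; rewrite GamE // /quadrature [in RHS]exchange_big /=.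
  transitivity (\sum_(l < k1) \sum_b b1 l * (P i).[c1 l] *
      (Sf a b (pcurve v h (c1 l)) * (gamma_poly b h).[c1 l]) -
    \sum_(l < k1) \sum_b b1 l * (P i).[c1 l] *
      ((sg a b h).[c1 l] * (gamma_poly b h).[c1 l])).
    rewrite -sumrB; apply: eq_bigr => l _; rewrite -sumrB.
    by apply: eq_bigr => b _; ring.
  congr (_ - _).
    rewrite exchange_big /=; apply: eq_bigr => b _.
    under [RHS]eq_bigr do rewrite mulr_suml.
    rewrite exchange_big /=; apply: eq_bigr => l _.
    rewrite /gamma_poly horner_sum mulrA mulr_sumr.
    by apply: eq_bigr => j _; rewrite hornerZ; ring.
  apply: eq_bigr => l _; rewrite hornerM /force_poly horner_sum mulrA mulr_sumr.
  by apply: eq_bigr => b _; rewrite hornerM.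
apply: uniformO_sum => l; apply: uniformO_sum => b.
have c1l : 0 <= c1 l <= 1.
  by apply: (legendre_root_itv P_legendre (k := k1)); case: gauss1 => _ + _; apply.
apply: uniformOMl; first exact: uniformO_cst.
apply: uniformOMr; first exact: (uniformO_at c1l (Sf_sg a b)).
exact: (uniformO_at c1l (graded_horner d_le1 (graded_gamma_poly b))).
Qed.

Lemma GamO i a : (i < s)%N -> uniformO d (minn i N) (fun h _ => Gam i a h).
Proof.
move=> si; have ik1 : (i < k1)%N by apply: leq_trans si s_le_k1.
apply: eq_uniformO (uniformOD (uniformO_le d_le1 (geq_minr _ _) (Gam_expansion a si))
  (uniformO_quadrature_legendre P_legendre d_le1 gauss1 ik1 (graded_force_poly a))).
by move=> h c _ _; rewrite subrK.
Qed.

Lemma graded_Gam a : graded d N (fun h => \sum_(i < s) Gam i a h *: P i).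
Proof.
apply: graded_sum => i; apply: (@graded_scale _ _ d_le1 _ i).
  by rewrite size_legendre.
exact: GamO.
Qed.

Lemma graded_line_poly b : graded d N.+1 (v b).
Proof.
apply: gradedD; first exact: gradedC (uniformO_cst d (y0 b)).
exact/graded_primitive/graded_Gam.
Qed.

(** Up to [O(h^N)] this is the defect of the curve in the differential equation. With [sg] and [gg]
    in place of [Sf] and [g] it is a polynomial, to which the projection estimates apply. *)
Definition defect_poly a h : {poly R} :=
  \sum_(i < s) Gam i a h *: P i - \sum_b sg a b h * gg b h.

Lemma graded_defect_poly a : graded d N (defect_poly a).
Proof.
apply: gradedB => //; first exact: graded_Gam.
by apply: graded_sum => b; exact: gradedM.
Qed.

(* Two discrete projections occur: of the force, through the quadrature of [S],
   and of [gg], through the quadrature of the gradient. *)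
Lemma defect_orthogonal a x : (s + s <= N)%N -> graded d N x ->
  uniformO d (s + s) (fun h _ => int01 (x h * defect_poly a h)).
Proof.
move=> sN xN.
have E1 := uniformO_discrete_projection P_legendre d_le1 gauss1 s_le_k1 sN xN
  (graded_force_poly a) (fun i si => Gam_expansion a si).
(* The expansion of [Sf] is absorbed into the test polynomial. *)
have E2 b := uniformO_discrete_projection P_legendre d_le1 gauss2 s_le_k2 sN
  (gradedM d_le1 xN (sgN a b)) (ggN b) (fun j _ => gamma_expansion j b).
apply: eq_uniformO (uniformOD E1 (uniformO_sum (index_enum 'I_m) E2)) => h c _ _.
have distr (F : 'I_m -> {poly R}) : int01 (x h * \sum_b sg a b h * F b) =
    \sum_b int01 (x h * sg a b h * F b).
  by rewrite mulr_sumr linear_sum; apply: eq_bigr => b _; rewrite mulrA.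
rewrite sumrB /defect_poly mulrBr linearB /= distr /force_poly distr.
by rewrite addrA subrK.
Qed.

(* The component along [P i] is [O(h^(2s - i))]: test with [h^i P_i]. *)
Lemma defectO a : (s + s <= N)%N ->
  uniformO d s (fun h c => (defect_poly a h).[c]).
Proof.
move=> sN.
have legO i : (i < s)%N -> uniformO d s (fun h _ => int01 (P i * defect_poly a h)).
  move=> si.
  have /uniformO_bound[C C0 DC] : uniformO d (s + s)
      (fun h _ => int01 ((h ^+ i *: P i) * defect_poly a h)).
    apply: defect_orthogonal => //; apply: (@graded_scale _ _ d_le1 _ i).
      by rewrite size_legendre.
    exact: uniformO_le (geq_minl _ _) (uniformO_exp _ _).
  exists C => h c hd c01; have := DC h c hd c01.
  have h0 : 0 < h by case/andP: hd.
  have h1 : h <= 1 by case/andP: hd => _ /ltW hd; exact: le_trans hd d_le1.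
  rewrite -scalerAl linearZ /= normrM ger0_norm ?exprn_ge0 ?(ltW h0) // => hD.
  rewrite -(@ler_pM2l _ (h ^+ i)) ?exprn_gt0 //; apply: le_trans hD _.
  rewrite mulrCA -exprD ler_wpM2l // ler_wiXn2l ?(ltW h0) //.
  by rewrite leq_add2r ltnW.
(* The part of the defect outside degree below [s] is small by gradedness alone; [legO] treats the
   remaining components. *)
have E1 := uniformO_proj_error P_legendre d_le1
  (leq_trans (leq_addr _ _) sN) (graded_defect_poly a).
have E2 : uniformO d s (fun h c => (proj P s (defect_poly a h)).[c]).
  apply: (@eq_uniformO _ _ _ (fun h c =>
      \sum_(i < s) int01 (P i * defect_poly a h) * (P i).[c])).
    move=> h c _ _; rewrite /proj horner_sum.
    by apply: eq_bigr => i _; rewrite hornerZ.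
  apply: uniformO_sum => i; apply: uniformOMr; first exact: legO.
  exact: (graded_horner d_le1 (graded_cst d (P i))).
apply: eq_uniformO (uniformOD E1 E2) => h c _ _.
by rewrite hornerD hornerN subrK.
Qed.

End Expansion.

Context (K : set 'cV[R]_m).
Hypothesis Sf_regular : forall a b n, regular K n (Sf a b).
Hypothesis g_regular : forall b n, regular K n (g b).
Hypothesis v_in_K : forall h c : R, 0 < h < d -> 0 <= c <= 1 -> K (pcurve v h c).

(** Bootstrap: boundedness on [K] gives expansions of order 0 and so a curve graded to order 1.
    Composition passes the order of the curve on to [Sf] and [g], and the method returns it to the
    curve increased by one. *)
Lemma line_expansion N : exists (sg : 'I_m -> 'I_m -> R -> {poly R})
    (gg : 'I_m -> R -> {poly R}),
  [/\ forall a b, graded d N (sg a b), forall b, graded d N (gg b),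
      forall a b, uniformO d N (fun h c => Sf a b (pcurve v h c) - (sg a b h).[c]),
      forall b, uniformO d N (fun h c => g b (pcurve v h c) - (gg b h).[c]) &
      forall b, graded d N (v b)].
Proof.
have from_approx M : (forall a b, approx d M (fun h c => Sf a b (pcurve v h c))) ->
    (forall b, approx d M (fun h c => g b (pcurve v h c))) ->
    exists (sg : 'I_m -> 'I_m -> R -> {poly R}) (gg : 'I_m -> R -> {poly R}),
  [/\ forall a b, graded d M (sg a b), forall b, graded d M (gg b),
      forall a b, uniformO d M (fun h c => Sf a b (pcurve v h c) - (sg a b h).[c]),
      forall b, uniformO d M (fun h c => g b (pcurve v h c) - (gg b h).[c]) &
      forall b, graded d M.+1 (v b)].
  move=> SM gM.
  have [sg [sgM Ssg]] := approx_choice (fun ab : 'I_m * 'I_m => SM ab.1 ab.2).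
  have [gg [ggM ggg]] := approx_choice gM.
  exists (fun a b => sg (a, b)), gg; split => //.
  - by move=> a b; exact: (Ssg (a, b)).
  - move=> b; apply: (@graded_line_poly M (fun a b => sg (a, b)) gg) => //.
    by move=> a' b'; exact: (Ssg (a', b')).
have v_graded : forall M b, graded d M (v b).
  have v1 b : graded d 1 (v b).
    have [||? [? [_ _ _ _]]] := from_approx 0%N; last by apply.
      by move=> a' b'; apply/approx0/(uniformO_regular (Sf_regular a' b' 0) v_in_K).
    by move=> b'; apply/approx0/(uniformO_regular (g_regular b' 0) v_in_K).
  elim=> [|M IHM] b; first exact: graded_le (v1 b).
  have [||? [? [_ _ _ _]]] := from_approx M; last by apply.
    by move=> a' b'; exact: (approx_comp d_le1 (Sf_regular a' b' M) IHM v_in_K).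
  by move=> b'; exact: (approx_comp d_le1 (g_regular b' M) IHM v_in_K).
have [||sg [gg [sgN ggN Ssg ggg _]]] := from_approx N; last by exists sg, gg.
  by move=> a b; exact: (approx_comp d_le1 (Sf_regular a b N) (v_graded N) v_in_K).
by move=> b; exact: (approx_comp d_le1 (g_regular b N) (v_graded N) v_in_K).
Qed.

End LineIntegral.

(** * Superconvergence *)

Section Adjoint.
Context {R : realType} (d : R) {m : nat} (N : nat).
Hypothesis d_le1 : d <= 1.
Context (al : 'I_m -> 'I_m -> R -> {poly R}) (k : 'I_m).
Hypothesis alN : forall a b, graded d N (al a b).

(* Picard iterates of the adjoint equation [x_b' = - h \sum_a x_a al_ab],
   [x(1)] the [k]-th unit vector. *)
Fixpoint adjoint n b (h : R) : {poly R} :=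
  if n is n'.+1 then
    let q := h *: primitive (\sum_a adjoint n' a h * al a b h) in
    (k == b)%:R%:P + q.[1]%:P - q
  else (k == b)%:R%:P.

Lemma graded_adjoint n b : graded d N (adjoint n b).
Proof.
elim: n b => [|n IHn] b; first exact: gradedC (uniformO_cst d _).
have qN : graded d N (fun h => h *: primitive (\sum_a adjoint n a h * al a b h)).
  apply: (graded_le d_le1 (leqnSn N)); apply: graded_primitive.
  by apply: graded_sum => a; exact: gradedM.
apply: gradedB => //; apply: gradedD; first exact: gradedC (uniformO_cst d _).
apply: gradedC; apply: (uniformO_at _ (graded_horner d_le1 qN)).
by rewrite ler01 lexx.
Qed.

Lemma adjoint_horner1 n b h : (adjoint n b h).[1] = (k == b)%:R.
Proof.
by case: n => [|n]; rewrite /= ?hornerC // hornerD hornerN hornerD !hornerC addrK.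
Qed.

Lemma deriv_adjoint n b h :
  (adjoint n.+1 b h)^`() = - (h *: \sum_a adjoint n a h * al a b h).
Proof.
by rewrite /= derivB derivD !derivC derivZ deriv_primitive !add0r.
Qed.

(** Contraction of the Picard iteration: consecutive iterates agree at [c = 1], and each integration
    contributes a factor [h]. *)
Lemma adjoint_diffO n b :
  uniformO d n (fun h c => (adjoint n.+1 b h - adjoint n b h).[c]).
Proof.
elim: n b => [|n IHn] b.
  exact: graded_horner (gradedB _ (graded_adjoint _ _) (graded_adjoint _ _)).
pose D h := adjoint n.+2 b h - adjoint n.+1 b h.
have D1 h : (D h).[1] = 0.
  by rewrite /D hornerD hornerN !adjoint_horner1 subrr.
(* [uniformO_mean_value] starts at 0 whereas [D] vanishes at 1: the increment from 0 is estimated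
   first, then its value at 1 is subtracted. *)
have FO : uniformO d n.+1 (fun h c => (D h).[c] - (D h).[0]).
  apply: (uniformO_mean_value (F' := fun h c => (D h)^`().[c])).
  - by move=> h _; rewrite subrr.
  - move=> h _; apply: derivable_within_continuous => c _.
    have -> : (fun c => (D h).[c] - (D h).[0]) = horner (D h - (D h).[0]%:P).
      by apply/funext => t; rewrite !hornerE.
    exact: derivable_horner.
  - move=> h c _ _.
    have -> : (fun c => (D h).[c] - (D h).[0]) = horner (D h - (D h).[0]%:P).
      by apply/funext => t; rewrite !hornerE.
    by apply: is_derive_eq; rewrite derivB derivC subr0.
  apply: (@eq_uniformO _ _ _ (fun h c => h * - \sum_a
      (adjoint n.+1 a h - adjoint n a h).[c] * (al a b h).[c])).
    move=> h c _ _; rewrite /D derivB !deriv_adjoint -opprD -scalerBr.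
    rewrite -sumrB hornerN hornerZ mulrN horner_sum; congr (- (h * _)).
    by apply: eq_bigr => a _; rewrite -mulrBl hornerM.
  rewrite -add1n; apply: uniformOM; first exact: uniformO_id.
  apply: uniformON; apply: uniformO_sum => a; apply: uniformOMr => //.
  exact: graded_horner.
have F1 : uniformO d n.+1 (fun h _ => (D h).[1] - (D h).[0]).
  by apply: (uniformO_at _ FO); rewrite ler01 lexx.
by apply: eq_uniformO (uniformOB FO F1) => h c _ _; rewrite D1 sub0r opprK subrK.
Qed.

End Adjoint.

Lemma continuous_horner_mul_sum (R : realType) (A : set R) m (p : 'I_m -> {poly R})
    (F : 'I_m -> R -> R) : (forall a, {within A, continuous (F a)}) ->
  {within A, continuous (fun c => \sum_a (p a).[c] * F a c)}.
Proof.
move=> Fc; rewrite /index_enum; elim: (Finite.enum _) => [|a r IHr] x.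
  have -> : (fun c => \sum_(a <- [::]) (p a).[c] * F a c) = cst 0.
    by apply/funext => c; rewrite big_nil.
  exact: cst_continuous.
have -> : (fun c => \sum_(a <- a :: r) (p a).[c] * F a c) =
    horner (p a) * F a + (fun c => \sum_(a <- r) (p a).[c] * F a c).
  by apply/funext => c; rewrite big_cons.
apply: continuousD; last exact: IHr.
apply: continuousM; last exact: Fc.
exact/continuous_subspaceT/continuous_horner.
Qed.

(** * The error equation and the error at the end of the step *)

Section Convergence.
Context {R : realType} (d : R) {m : nat} (P : nat -> {poly R}) (s k1 k2 : nat).
Hypotheses (d_le1 : d <= 1) (P_legendre : legendre_basis P).
Context (c1 b1 : 'I_k1 -> R) (c2 b2 : 'I_k2 -> R).
Hypotheses (gauss1 : gauss_legendre P c1 b1) (gauss2 : gauss_legendre P c2 b2).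
Hypotheses (s_le_k1 : (s <= k1)%N) (s_le_k2 : (s <= k2)%N).
Context (Sf : 'I_m -> 'I_m -> 'cV[R]_m -> R) (g : 'I_m -> 'cV[R]_m -> R).
Context (y0 : 'I_m -> R) (Gam : nat -> 'I_m -> R -> R) (K : set 'cV[R]_m).
Hypothesis GamE : line_system d P s c1 b1 c2 b2 Sf g y0 Gam.
Hypothesis Sf_regular : forall a b n, regular K n (Sf a b).
Hypothesis g_regular : forall b n, regular K n (g b).

Local Notation v := (line_poly P s y0 Gam).

(** [Y h c] stands for the exact solution at time [c h]. *)
Context (Y : R -> R -> 'cV[R]_m).
Hypothesis Y_start : forall (h : R) a, 0 < h < d -> Y h 0 a ord0 = y0 a.
Hypothesis Y_cont : forall (h : R) a, 0 < h < d ->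
  {within `[0, 1], continuous (fun c => Y h c a ord0)}.
Hypothesis Y_der : forall (h c : R) a, 0 < h < d -> 0 < c < 1 ->
  is_derive c (1 : R) (fun c => Y h c a ord0)
    (h * \sum_b Sf a b (Y h c) * g b (Y h c)).
Hypothesis vY : forall h c : R, 0 < h < d -> 0 <= c <= 1 ->
  segment_in K (pcurve v h c) (Y h c).

Definition field a (x : 'cV[R]_m) : R := \sum_b Sf a b x * g b x.

Lemma regular_field n a : regular K n (field a).
Proof. by apply: regular_sum => b; exact: regularM. Qed.

Definition err a (h c : R) : R := (v a h).[c] - Y h c a ord0.

Lemma err_start a h : 0 < h < d -> err a h 0 = 0.
Proof.
by move=> hd; rewrite /err Y_start // !hornerE primitive_horner0 mulr0 addr0 subrr.
Qed.

Lemma err_cont a h : 0 < h < d -> {within `[0, 1], continuous (err a h)}.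
Proof.
move=> hd x; apply: continuousB; last exact: Y_cont.
exact/continuous_subspaceT/continuous_horner.
Qed.

Lemma err_der a (h c : R) : 0 < h < d -> 0 < c < 1 ->
  is_derive c (1 : R) (err a h)
    (h * ((\sum_(i < s) Gam i a h *: P i).[c] - field a (Y h c))).
Proof.
move=> hd c01; have dY := Y_der a hd c01.
apply: is_derive_eq.
by rewrite derivD derivC derivZ deriv_primitive add0r hornerZ mulrBr.
Qed.

Let v_in_K (h c : R) : 0 < h < d -> 0 <= c <= 1 -> K (pcurve v h c).
Proof. by move=> hd c01; exact: segment_in_l (vY hd c01). Qed.

Let Y_in_K (h c : R) : 0 < h < d -> 0 <= c <= 1 -> K (Y h c).
Proof.
move=> hd c01; have := vY hd c01 (t := 1); rewrite scale1r subrKC; apply.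
by rewrite ler01 lexx.
Qed.

Let normE h c : \sum_b `|Y h c b ord0 - pcurve v h c b ord0| = \sum_b `|err b h c|.
Proof. by apply: eq_bigr => b _; rewrite distrC mxE. Qed.

Lemma err_field_lipschitz n a : (forall b, uniformO d n (err b)) ->
  uniformO d n (fun h c => field a (pcurve v h c) - field a (Y h c)).
Proof.
move=> eO; have [C C0 fC] := regular_lipschitz (regular_field 1 a).
apply: (uniformO_dominated (G := fun h c => C * \sum_b `|err b h c|)).
  by move=> h c hd c01; rewrite distrC -normE; apply/fC/vY.
apply: uniformOMl; first exact: uniformO_cst.
by apply: uniformO_sum => b; exact: uniformO_norm.
Qed.

(* [phi = \sum_a x_a err_a] has derivative [h \sum_a x_a D_a + O(h^(2s+1))]: the
   linear part of [field v - field Y] cancels against the adjoint equation. *)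
Lemma superconvergence k : uniformO d (s + s).+1 (fun h _ => err k h 1).
Proof.
(* Order [2 s] suffices: the remainders of the expansions enter the derivative of the error with a
   factor [h]. *)
pose N := (s + s)%N.
have [sg [gg [sgN ggN Ssg ggg vN]]] := line_expansion d_le1 P_legendre gauss1 gauss2
  s_le_k1 s_le_k2 GamE Sf_regular g_regular v_in_K N.
pose D := defect_poly P s Gam sg gg.
have DO a : uniformO d s (fun h c => (D a h).[c]).
  exact: (defectO d_le1 P_legendre gauss1 gauss2 s_le_k1 s_le_k2 GamE sgN ggN Ssg ggg).
have DN a : graded d N (D a).
  exact: (graded_defect_poly d_le1 P_legendre gauss1 gauss2 s_le_k1 s_le_k2 GamE
    sgN ggN Ssg ggg).
have Dorth a x : graded d N x -> uniformO d N (fun h _ => int01 (x h * D a h)).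
  exact: (defect_orthogonal d_le1 P_legendre gauss1 gauss2 s_le_k1 s_le_k2 GamE
    sgN ggN Ssg ggg).
have fieldO a : uniformO d N
    (fun h c => (\sum_b sg a b h * gg b h).[c] - field a (pcurve v h c)).
  apply: (@eq_uniformO _ _ _ (fun h c => \sum_b
    - ((Sf a b (pcurve v h c) - (sg a b h).[c]) * (gg b h).[c] +
       Sf a b (pcurve v h c) * (g b (pcurve v h c) - (gg b h).[c])))).
    move=> h c _ _; rewrite horner_sum /field -sumrB.
    by apply: eq_bigr => b _; rewrite hornerM; ring.
  apply: uniformO_sum => b; apply: uniformON; apply: uniformOD.
    by apply: uniformOMr => //; exact: (graded_horner d_le1 (ggN b)).
  by apply: uniformOMl => //; exact: uniformO_regular (Sf_regular a b 0) v_in_K.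
have GamD a h : \sum_(i < s) Gam i a h *: P i = D a h + \sum_b sg a b h * gg b h.
  by rewrite /D /defect_poly subrK.
(* Integrating the error equation gains one order, as long as the defect, which is [O(h^s)], allows
   it. Boundedness of [field] starts the induction and its Lipschitz bound continues it. *)
have err_step n : (n <= s)%N -> (forall a, uniformO d n (fun h c =>
    field a (pcurve v h c) - field a (Y h c))) ->
    forall a, uniformO d n.+1 (err a).
  move=> ns fO a; apply: (uniformO_mean_value (@err_start a) (@err_cont a) (@err_der a)).
  rewrite -add1n; apply: uniformOM; first exact: uniformO_id.
  have nN : (n <= N)%N by apply: leq_trans ns (leq_addr _ _).
  apply: eq_uniformO (uniformOD (uniformO_le d_le1 ns (DO a))
    (uniformOD (uniformO_le d_le1 nN (fieldO a)) (fO a))) => h c _ _.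
  by rewrite GamD hornerD; ring.
have errO n : (n <= s)%N -> forall a, uniformO d n.+1 (err a).
  elim: n => [|n IHn] ns; apply: err_step => // a.
    apply: uniformOB; first exact: uniformO_regular (regular_field 0 a) v_in_K.
    exact: uniformO_regular (regular_field 0 a) Y_in_K.
  by apply: err_field_lipschitz; exact: IHn (ltnW ns).
have {errO}eO a : uniformO d s.+1 (err a) by exact: errO.
(* Order 1 is for the Taylor bound, order [N] for the expansion of [G] along the curve. *)
have /choice[G fG] : forall a, exists G, has_partials K (field a) G /\
    forall b, regular K (maxn 1 N) (G b).
  by move=> a; have [G fG GN] := regularS (regular_field (maxn 1 N).+1 a); exists G.
have G1 a b : regular K 1 (G a b).
  by apply: regular_le (leq_maxl 1 N) _; case: (fG a).
have [al [alN Gal]] : exists al : 'I_m * 'I_m -> R -> {poly R},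
    (forall ab, graded d N (al ab)) /\ forall ab,
    uniformO d N (fun h c => G ab.1 ab.2 (pcurve v h c) - (al ab h).[c]).
  apply: approx_choice => -[a b]; apply: (approx_comp d_le1 _ vN v_in_K).
  by apply: regular_le (leq_maxr 1 N) _; case: (fG a).
have taylor a : uniformO d (s.+1 + s.+1) (fun h c => field a (pcurve v h c) -
    field a (Y h c) - \sum_b G a b (pcurve v h c) * err b h c).
  have [C fC] := regular_taylor2 (proj1 (fG a)) (G1 a).
  apply: (uniformO_dominated (G := fun h c => C * (\sum_b `|err b h c|) ^+ 2)).
    move=> h c hd c01; have := fC _ _ (vY hd c01); rewrite normE.
    apply: le_trans; rewrite -normrN le_eqVlt; apply/orP; left; apply/eqP.
    congr `|_|; rewrite !opprB addrC; congr (_ + _); rewrite -sumrN.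
    by apply: eq_bigr => b _; rewrite /err !mxE; ring.
  apply: uniformOMl; first exact: uniformO_cst.
  have eS : uniformO d s.+1 (fun h c => \sum_b `|err b h c|).
    by apply: uniformO_sum => b; exact: uniformO_norm.
  exact: (uniformOM eS eS).
pose al' a b := al (a, b).
have alN' a b : graded d N (al' a b) by exact: alN.
(* After [s.+1] iterations the residual in the adjoint equation is [O(h^(s+1))]; its product with
   the error, also [O(h^(s+1))], is negligible. *)
pose x b h := adjoint al' k s.+1 b h.
have xN b : graded d N (x b) by exact: graded_adjoint.
have xadj b : uniformO d s.+1 (fun h c => (x b h)^`().[c] +
    h * \sum_a (x a h).[c] * (al' a b h).[c]).
  apply: (@eq_uniformO _ _ _ (fun h c => h * \sum_a
      (adjoint al' k s.+1 a h - adjoint al' k s a h).[c] * (al' a b h).[c])).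
    move=> h c _ _; rewrite /x deriv_adjoint hornerN hornerZ horner_sum.
    rewrite addrC -mulrBr -sumrB; congr (_ * _); apply: eq_bigr => a _.
    by rewrite hornerM -mulrBl hornerD hornerN.
  rewrite -add1n; apply: uniformOM; first exact: uniformO_id.
  apply: uniformO_sum => a; apply: uniformOMr; first exact: adjoint_diffO.
  exact: graded_horner.
pose phi h c := \sum_a (x a h).[c] * err a h c.
pose phi' h c := \sum_a ((x a h)^`().[c] * err a h c + (x a h).[c] *
  (h * ((\sum_(i < s) Gam i a h *: P i).[c] - field a (Y h c)))).
pose q h := \sum_a x a h * D a h.
have qO : uniformO d N.+1 (fun h c => phi h c - (h *: primitive (q h)).[c]).
  apply: (uniformO_mean_value (F' := fun h c => phi' h c - h * (q h).[c])).
  - move=> h hd; rewrite hornerZ primitive_horner0 mulr0 subr0 /phi big1 // => a _.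
    by rewrite err_start // mulr0.
  - move=> h hd t; apply: continuousB; last first.
      exact/continuous_subspaceT/continuous_horner.
    by apply: continuous_horner_mul_sum => a; exact: err_cont.
  - move=> h c hd c01; apply: is_deriveB; last first.
      by apply: is_derive_eq; rewrite derivZ deriv_primitive hornerZ.
    apply: is_derive_sum_fun => a; have de := err_der a hd c01.
    apply: (is_derive_eq (is_deriveM (is_derive_poly (x a h) c) de)).
    rewrite /GRing.scale /=; ring.
  have e1 : (N.+1 <= s.+1 + s.+1)%N by rewrite /N; lia.
  (* [phi' - h q] is the adjoint residual times the error ([e2]), plus [h] times the expansion error
     of the field, the Taylor remainder and the cost of replacing [G] by [al] ([e3]). *)
  have e2 : uniformO d N.+1 (fun h c => \sum_b ((x b h)^`().[c] +
      h * \sum_a (x a h).[c] * (al' a b h).[c]) * err b h c).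
    by apply: uniformO_sum => b; apply: (uniformO_le d_le1 e1); exact: uniformOM.
  have e3 : uniformO d N.+1 (fun h c => \sum_a h * ((x a h).[c] *
     (((\sum_b sg a b h * gg b h).[c] - field a (pcurve v h c)) +
      (field a (pcurve v h c) -
         field a (Y h c) - \sum_b G a b (pcurve v h c) * err b h c) +
      \sum_b (G a b (pcurve v h c) - (al' a b h).[c]) * err b h c))).
    apply: uniformO_sum => a; rewrite -add1n; apply: uniformOM.
      exact: uniformO_id.
    apply: uniformOMl; first exact: graded_horner.
    apply: uniformOD; first apply: uniformOD => //.
      by apply: uniformO_le (taylor a) => //; exact: leq_trans e1.
    apply: uniformO_sum => b; apply: uniformOMr; first exact: (Gal (a, b)).
    exact: uniformO_le (eO b).
  apply: eq_uniformO (uniformOD e2 e3) => h c _ _.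
  have e4 : phi' h c = h * (q h).[c] + (\sum_b (x b h)^`().[c] * err b h c +
      \sum_a h * ((x a h).[c] * ((\sum_b sg a b h * gg b h).[c] - field a (Y h c)))).
    rewrite /phi' /q horner_sum mulr_sumr -!big_split /=.
    by apply: eq_bigr => a _; rewrite GamD hornerD hornerM; ring.
  rewrite e4 [h * _ + _]addrC addrK.
  have -> : \sum_b ((x b h)^`().[c] + h * \sum_a (x a h).[c] * (al' a b h).[c]) *
      err b h c = \sum_b (x b h)^`().[c] * err b h c +
      \sum_a h * ((x a h).[c] * \sum_b (al' a b h).[c] * err b h c).
    under [X in _ = _ + X]eq_bigr do rewrite !mulr_sumr.
    rewrite exchange_big -big_split /=; apply: eq_bigr => b _.
    rewrite mulrDl mulr_sumr mulr_suml; congr (_ + _).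
    by apply: eq_bigr => a _; ring.
  rewrite -addrA -big_split /=; congr (_ + _); apply: eq_bigr => a _.
  under [\sum_b (_ - _) * _]eq_bigr do rewrite mulrBl.
  rewrite sumrB; ring.
have q1 : uniformO d N.+1 (fun h _ => phi h 1 - (h *: primitive (q h)).[1]).
  by apply: (uniformO_at _ qO); rewrite ler01 lexx.
(* At [c = 1] the primitive is the full integral of the defect against [x], where orthogonality
   applies. *)
have q2 : uniformO d N.+1 (fun h _ => (h *: primitive (q h)).[1]).
  apply: (@eq_uniformO _ _ _ (fun h _ => h * \sum_a int01 (x a h * D a h))).
    by move=> h c _ _; rewrite hornerZ -int01E /q linear_sum.
  rewrite -add1n; apply: uniformOM; first exact: uniformO_id.
  by apply: uniformO_sum => a; exact: Dorth.
apply: eq_uniformO (uniformOD q1 q2) => h c _ _.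
(* At [c = 1] the adjoint is the [k]-th unit vector, which selects one component. *)
rewrite subrK /phi (bigD1 k) //= adjoint_horner1 eqxx mul1r.
rewrite big1 ?addr0 // => a ak.
by rewrite adjoint_horner1 eq_sym (negbTE ak) mul0r.
Qed.

End Convergence.

(** * Application to the method and the exact solution *)

Lemma within_continuous_reparam (U V W : topologicalType) (A : set U) (B : set V)
    (f : V -> W) (phi : U -> V) :
  continuous phi -> (forall x, A x -> B (phi x)) ->
  {within B, continuous f} -> {within A, continuous (f \o phi)}.
Proof.
move=> phic AB /subspace_continuousP fc; apply/subspace_continuousP => x Ax.
apply: cvg_comp (fc _ (AB _ Ax)) => Z; rewrite /= !nbhs_simpl /within /= => BZ.
have := phic x _ BZ; rewrite /= !nbhs_simpl /=.
by apply: filterS => t BZt At; exact/BZt/AB.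
Qed.

Theorem theorem4 (R : realType) (m s k1 k2 : nat)
    (y0 : 'cV[R]_m) (S : 'cV[R]_m -> 'M[R]_m) (H : 'cV[R]_m -> R)
    (U K : set 'cV[R]_m)
    (P : nat -> {poly R})
    (c1 b1 : 'I_k1 -> R) (c2 b2 : 'I_k2 -> R)
    (T : R) (y : R -> 'cV[R]_m)
    (h0 : R) (u : R -> 'cV[{poly R}]_m)
    (s_ge1 : (1 <= s)%N) (k1_ges : (s <= k1)%N) (k2_ges : (s <= k2)%N)
    (S_skew : forall x, S x = - (S x)^T)
    (U_open : open U) (K_compact : compact K) (K_sub_U : K `<=` U)
    (K_nbhs : nbhs y0 K)
    (S_smooth : smooth U S)
    (H_diff : forall x, U x -> differentiable H x)
    (gradH_smooth : smooth U (gradient H))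
    (P_legendre : legendre_basis P)
    (gauss1 : gauss_legendre P c1 b1) (gauss2 : gauss_legendre P c2 b2)
    (T_gt0 : 0 < T)
    (y_sol : solves_ivp (fun x => S x *m gradient H x) y0 T y)
    (h0_gt0 : 0 < h0)
    (u_LIM : forall h : R, 0 < h < h0 ->
       LIM_poly s P c1 b1 c2 b2 S H y0 h (u h))
    (u_in_K : forall h : R, 0 < h < h0 ->
       forall t : R, 0 <= t <= h -> K (poly_curve (u h) t)) :
  (fun h : R => poly_curve (u h) h - y h) =O_ (0^'+)
    (fun h : R => h ^+ (2 * s).+1).
Proof.
have [y_start y_cont y_der] := y_sol.
pose Sf a b x := S x a b; pose g b x := gradient H x b ord0.
have Sf_regular a b n : regular K n (Sf a b).
  exact: (Ck_regular a b K_compact K_sub_U (S_smooth n)).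
have g_regular b n : regular K n (g b).
  exact: (Ck_regular b ord0 K_compact K_sub_U (gradH_smooth n)).
pose Gam i a h := LIM_Gamma s P c1 b1 c2 b2 S H h (poly_curve (u h)) i a ord0.
pose v := line_poly P s (fun a => y0 a ord0) Gam.
(* The line polynomial built from the coefficients of [u h] is [u h] itself in rescaled time. *)
have vE (h c : R) : 0 < h < h0 -> 0 <= c <= 1 ->
    pcurve v h c = poly_curve (u h) (c * h).
  move=> hd c01; have [_ ->] := u_LIM h hd => //.
  apply/colP => a; rewrite !mxE /v /line_poly hornerD hornerC hornerZ.
  congr (_ + _ * _).
  rewrite summxE linear_sum horner_sum; apply: eq_bigr => i _.
  rewrite linearZ hornerZ mxE integral_polyE; last by case/andP: c01.
  by rewrite primitive_horner0 subr0 mulrC.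
have nodes k (c b : 'I_k -> R) l : gauss_legendre P c b -> 0 <= c l <= 1.
  by move=> [_ Pc _]; exact: (legendre_root_itv P_legendre (Pc l)).
have GamE d : d <= h0 -> line_system d P s c1 b1 c2 b2 Sf g (fun a => y0 a ord0) Gam.
  move=> dh i a h si /andP[h_gt0 hd].
  have hh0 : 0 < h < h0 by rewrite h_gt0 (lt_le_trans hd).
  rewrite /Gam /LIM_Gamma summxE; apply: eq_bigr => j _.
  rewrite mxE; apply: eq_bigr => b _; congr (_ * _).
    rewrite /LIM_rho summxE; apply: eq_bigr => l _.
    by rewrite mxE (vE h _ hh0 (nodes _ _ _ l gauss1)).
  rewrite /LIM_gamma /line_gamma summxE; apply: eq_bigr => l _.
  by rewrite mxE (vE h _ hh0 (nodes _ _ _ l gauss2)).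
have v_in_K (h c : R) : 0 < h < h0 -> 0 <= c <= 1 -> K (pcurve v h c).
  move=> hd /andP[c0 c1_]; rewrite vE // ?c0 //; apply: u_in_K => //.
  have h_ge0 : 0 <= h by case/andP: hd => /ltW.
  by rewrite mulr_ge0 // ler_piMl.
(* Both curves will be kept in this ball, whose convexity puts the segments between them inside
   [K]. *)
have [r /= r_gt0 rK] : exists2 r : R, 0 < r & ball y0 r `<=` K.
  by have /nbhs_ballP[r r_gt0 rK] := K_nbhs; exists r.
have [d1 [d1_gt0 d1_le1 d1_h0]] : exists d1 : R, [/\ 0 < d1, d1 <= 1 & d1 <= h0].
  by exists (Num.min 1 h0); rewrite lt_min ltr01 h0_gt0 !ge_min !lexx orbT.
have v_near : exists2 C : R, 0 < C & forall (h c : R) a, 0 < h < d1 ->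
    0 <= c <= 1 -> `|(v a h).[c] - y0 a ord0| <= C * h.
  have v_in_K1 (h c : R) : 0 < h < d1 -> 0 <= c <= 1 -> K (pcurve v h c).
    by move=> /andP[h_gt0 hd]; apply: v_in_K; rewrite h_gt0 (lt_le_trans hd).
  have [_ [_ [_ _ _ _ vN]]] := line_expansion d1_le1 P_legendre gauss1 gauss2
    k1_ges k2_ges (GamE _ d1_h0) Sf_regular g_regular v_in_K1 1.
  have /choice[C CP] : forall a, exists C, 0 <= C /\ forall h c : R, 0 < h < d1 ->
      0 <= c <= 1 -> `|(v a h).[c] - (v a h).[0]| <= C * h ^+ 1.
    move=> a; have /uniformO_bound[C C0 CP] : uniformO d1 1
        (fun h c => (v a h).[c] - (v a h).[0]).
      (* Subtracting the value at 0 kills constants, so a curve graded to order 1 moves by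
         [O(h)]. *)
      apply: (uniformO_scalar d1_le1 (n := 1) (N := 1)
        (L := fun c f => f.[c] - f.[0])) => // [c x p q|l|l c].
      - by rewrite !(hornerD, hornerZ); ring.
      - by apply: uniformOB; exact: (graded_horner d1_le1 (graded_cst d1 'X^l)) ||
          exact: uniformO_cst.
      - by case: l => // _; rewrite expr0 !hornerC subrr.
    by exists C.
  (* The summand 1 makes the constant positive, for the division in [r / C]. *)
  exists (1 + \sum_a C a) => [|h c a hd c01].
    by rewrite ltr_pwDl // sumr_ge0 // => a _; case: (CP a).
  have := (CP a).2 h c hd c01; rewrite {2}/v /line_poly hornerD hornerC hornerZ.
  rewrite primitive_horner0 mulr0 addr0 expr1 => /le_trans; apply.
  rewrite ler_wpM2r //; first by case/andP: hd => /ltW.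
  rewrite (bigD1 a) //= addrCA lerDl addr_ge0 // sumr_ge0 // => b _.
  by case: (CP b).
have [C C_gt0 vC] := v_near.
have [rho rho_gt0 y_near] : exists2 rho : R, 0 < rho &
    forall t : R, 0 <= t <= T -> t < rho -> ball y0 r (y t).
  have : y t @[t --> within `[0, T] (nbhs (0 : R))] --> y0.
    rewrite -y_start; move/subspace_continuousP : y_cont => /(_ 0); apply.
    by rewrite /= in_itv /= lexx ltW.
  move=> /(_ _ (nbhsx_ballx _ _ r_gt0)).
  rewrite /= !nbhs_simpl /within /= => /nbhs_ballP[rho /= rho_gt0 yr].
  exists rho => // t t0T trho; apply: yr; last by rewrite in_itv.
  by rewrite /ball /= sub0r normrN ger0_norm //; case/andP: t0T.
(* [T] bounds the interval of the solution; [r / C] keeps the numerical curve in the ball and [rho]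
   the exact one. *)
have [d [d_gt0 d_d1 d_T d_rC d_rho]] :
    exists d : R, [/\ 0 < d, d <= d1, d <= T, d <= r / C & d <= rho].
  exists (Num.min (Num.min d1 T) (Num.min (r / C) rho)).
  by rewrite !lt_min !ge_min !lexx d1_gt0 T_gt0 rho_gt0 divr_gt0 // !orbT.
pose Y (h c : R) := y (c * h).
have conv k : uniformO d (s + s).+1 (fun h _ => err P s (fun a => y0 a ord0) Gam Y k h 1).
  apply: (superconvergence (le_trans d_d1 d1_le1) P_legendre gauss1 gauss2 k1_ges k2_ges
    (GamE _ (le_trans d_d1 d1_h0)) Sf_regular g_regular).
  - by move=> h a _; rewrite /Y mul0r y_start.
  - move=> h a /andP[h_gt0 hd].
    apply: (@within_continuous_reparam R R R `[0, 1]%classic `[0, T]%classic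
      (fun t => y t a ord0) (fun c : R => c * h)) => [|c|].
    + exact: mulrr_continuous.
    + rewrite /= !in_itv /= => /andP[c_ge0 c_le1].
      rewrite mulr_ge0 ?(ltW h_gt0) //= (le_trans _ (le_trans (ltW hd) d_T)) //.
      by rewrite ler_piMl // ltW.
    + apply: (@within_continuous_comp _ _ _ _ y (fun M : 'cV[R]_m => M a ord0)) => //.
      by move=> M _; exact: coord_continuous.
  - move=> h c a /andP[h_gt0 hd] /andP[c_gt0 c_lt1].
    have ch : 0 < c * h < T.
      rewrite mulr_gt0 //= (lt_le_trans _ (le_trans (ltW hd) d_T)) //.
      by rewrite gtr_pMl.
    have [yd yE] := y_der _ ch.
    have ya : is_derive (c * h) (1 : R) (fun t => y t a ord0)
        ((S (y (c * h)) *m gradient H (y (c * h))) a ord0).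
      apply: DeriveDef; first exact: (derivable_mxP _ _ _).1.
      by rewrite -yE derive_mx // mxE.
    have ch' : is_derive c (1 : R) (fun c => c * h) h.
      have -> : (fun c => c * h) = horner (h *: 'X).
        by apply/funext => t; rewrite hornerZ hornerX mulrC.
      by apply: is_derive_eq; rewrite derivZ derivX hornerZ hornerC mulr1.
    have := @is_derive1_comp R (fun t => y t a ord0) (fun c => c * h) c _ _ ya ch';
    rewrite mulrC mxE; exact.
  - move=> h c /andP[h_gt0 hd] c01 t /andP[t0 t1].
    apply: rK; split=> // a b; rewrite ord1 {b} /ball /= !mxE.
    have hd1 : 0 < h < d1 by rewrite h_gt0 (lt_le_trans hd).
    have va : `|y0 a ord0 - (v a h).[c]| < r.
      rewrite distrC; apply: le_lt_trans (vC h c a hd1 c01) _.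
      by rewrite mulrC -ltr_pdivlMr // (lt_le_trans hd).
    have ya : `|y0 a ord0 - y (c * h) a ord0| < r.
      have /andP[c_ge0 c_le1] := c01.
      have chh : c * h <= h by rewrite ler_piMl // ltW.
      have : ball y0 r (y (c * h)).
        apply: y_near; last by apply: le_lt_trans chh (lt_le_trans hd d_rho).
        rewrite mulr_ge0 ?(ltW h_gt0) //=.
        exact: le_trans chh (le_trans (ltW hd) d_T).
      by case=> _ /(_ a ord0).
    set p := (v a h).[c] in va *; set q := y (c * h) a ord0 in ya *.
    (* Convexity of the ball, entry by entry: the distance to a point of the segment is at most the
       larger of the two end distances. *)
    pose M := Num.max `|y0 a ord0 - p| `|y0 a ord0 - q|.
    apply: (@le_lt_trans _ _ M); last by rewrite gt_max va.
    have -> : y0 a ord0 - (p + t * (q - p)) =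
      (1 - t) * (y0 a ord0 - p) + t * (y0 a ord0 - q) by ring.
    have -> : M = (1 - t) * M + t * M by ring.
    apply: le_trans (ler_normD _ _) _; rewrite !normrM (ger0_norm t0).
    rewrite ger0_norm ?subr_ge0 // lerD // ler_wpM2l ?subr_ge0 //.
      by rewrite le_max lexx.
    by rewrite le_max lexx orbT.
have /choice[B B_conv] : forall k, exists B : R, forall h : R, 0 < h < d ->
    `|(poly_curve (u h) h - y h) k ord0| <= B * h ^+ (s + s).+1.
  move=> k; have [B BP] := conv k; exists B => h hd.
  have [h_gt0 hd'] := andP hd.
  have := BP h 1 hd; rewrite ler01 lexx => /(_ isT).
  rewrite /err /Y mul1r.
  have -> : (line_poly P s (fun a => y0 a ord0) Gam k h).[1] =
      poly_curve (u h) h k ord0.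
    rewrite -[X in poly_curve _ X]mul1r -vE ?mxE //.
      by rewrite h_gt0 (lt_le_trans hd') // (le_trans d_d1).
    by rewrite ler01 lexx.
  by rewrite !mxE.
(* The norm is the maximum of the entries, so one positive constant above every [B k] is enough. *)
apply/eqO_exP; exists (1 + \sum_k `|B k|) => /=.
  by rewrite ltr_pwDl // sumr_ge0.
near=> h.
have hd : 0 < h < d.
  by apply/andP; split; near: h; [exact: nbhs_right_gt|exact: nbhs_right_lt].
have h_ge0 : 0 <= h by case/andP: hd => /ltW.
have B_ge0 : 0 <= 1 + \sum_k `|B k| by rewrite addr_ge0 // sumr_ge0.
rewrite ger0_norm ?exprn_ge0 // [leLHS]/Num.norm /= mx_normrE.
apply: bigmax_le => [|[k l] _ /=]; first by rewrite mulr_ge0 ?exprn_ge0.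
rewrite (ord1 l) mul2n -addnn; apply: le_trans (B_conv k h hd) _.
rewrite ler_wpM2r ?exprn_ge0 //; apply: le_trans (ler_norm _) _.
by rewrite (bigD1 k) //= addrCA lerDl addr_ge0 // sumr_ge0.
Unshelve. all: by end_near. Qed.
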